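(* Let $k$ be an algebraically closed field, $V$ an $n$-dimensional $k$-vector space, $G=\mathrm{GL}(V)$, and let $(\mu;\nu)$ be a bipartition of $n$. Suppose $(v,x)\in\mathcal{O}_{\mu;\nu}$, and let $G^{(v,x)}$ be its stabiliser in $G$. Then $$G^{(v,x)}\cong U\rtimes\left(\left(\prod_{h\in J}\mathrm{GL}_{n_{l_h}-1}(k)\right)\times\left(\prod_{h\notin J}\mathrm{GL}_{n_{l_h}}(k)\right)\right)$$ where $U$ is unipotent and isomorphic (as a variety) to affine space of dimension $$b(\mu;\nu)-\sum_{h\notin J} n_{l_h}^2-\sum_{h\in J}(n_{l_h}-1)^2.$$
   Context: A partition is a non-increasing sequence $\lambda=(\lambda_1,\lambda_2,\dots)$ of natural numbers that is eventually $0$; $|\lambda|=\sum_i\lambda_i$, $l(\lambda)$ is the number of nonzero terms, and $n(\lambda)=\sum_{i\ge1}(i-1)\lambda_i$. A bipartition of $n$ is a pair of partitions $(\mu;\nu)$ such that $\mu+\nu$ (termwise sum) is a partition of $n$. Put $\lambda=\mu+\nu$ and $b(\mu;\nu)=|\nu|+2n(\mu)+2n(\nu)$. Let $l_1>l_2>\dots>l_s\geq 1$ be the distinct nonzero parts of $\lambda$, let $n_{l_h}>0$ be the multiplicity of $l_h$ in $\lambda$, and let $I_h=\{i : \lambda_i=l_h\}$. The sequences $\mu_i$ and $\nu_i$ are constant for $i\in I_h$; call the constant values $j_h$ and $k_h$ respectively, so $l_h=j_h+k_h$. Set $k_0=\infty$ and $j_{s+1}=0$, and $$J=\{h\in\{1,\dots,s\}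 : j_h>j_{h+1}\text{ and }k_h<k_{h-1}\}.$$ Products and sums over $h\notin J$ run over $h\in\{1,\dots,s\}\setminus J$. Let $\mathcal{N}\subset\mathrm{End}(V)$ be the set of nilpotent endomorphisms. The enhanced nilpotent cone is $V\times\mathcal{N}$ with $G$-action $g(v,x)=(gv,gxg^{-1})$. A Jordan basis for $x\in\mathcal{N}$ of Jordan type $\lambda$ is a basis $\{v_{ij} : 1\le i\le l(\lambda),1\le j\le\lambda_i\}$ of $V$ with $xv_{ij}=v_{i,j-1}$ for $j>1$ and $xv_{i1}=0$. The $G$-orbits in $V\times\mathcal{N}$ are in bijection with bipartitions of $n$: $\mathcal{O}_{\mu;\nu}$ is the orbit consisting of those $(v,x)$ such that $x$ has Jordan type $\mu+\nu$ and admits a Jordan basis $\{v_{ij}\}$ with $v=\sum_{i}v_{i\mu_i}$ (with $v_{i0}=0$). *)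

(* Defs.v *)
From HB Require Import structures.
From mathcomp Require Import all_boot all_order all_algebra.
From mathcomp Require Import mpoly.

Set Implicit Arguments.
Unset Strict Implicit.
Unset Printing Implicit Defensive.

Import GRing.Theory.

Local Open Scope ring_scope.

(** A partition, i.e. a non-increasing, eventually zero sequence of naturals,
    is the list of its nonzero terms.  Indices start at 0, so that the term
    usually written lambda_i is [part lam i.-1], and [part] is 0 past the end
    of the list. *)
Definition is_partition (lam : seq nat) : bool :=
  sorted geq lam && (0%N \notin lam).

Definition part (lam : seq nat) (i : nat) : nat := nth 0%N lam i.

Definition nstat (lam : seq nat) : nat :=
  (\sum_(i < size lam) i * part lam i)%N.

Definition addpart (mu nu : seq nat) : seq nat :=
  mkseq (fun i => part mu i + part nu i)%N (maxn (size mu) (size nu)).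

Definition bipartition (n : nat) (mu nu : seq nat) : Prop :=
  [/\ is_partition mu, is_partition nu & sumn (addpart mu nu) = n].

Definition bstat (mu nu : seq nat) : nat :=
  (sumn nu + 2 * nstat mu + 2 * nstat nu)%N.

Section DistinctParts.
Variables mu nu : seq nat.
Let lam := addpart mu nu.

(** Since [lam] is non-increasing, [undup lam] lists its distinct nonzero parts
    in decreasing order.  The index [h] runs over 0, ..., s - 1. *)
Definition nb_parts : nat := size (undup lam).

Definition dpart (h : nat) : nat := nth 0%N (undup lam) h.

Definition mult (h : nat) : nat := count_mem (dpart h) lam.

(** [index (dpart h) lam] is the least element of I_h, on which mu and nu are
    constant.  At [h = nb_parts] the value of [jval] is the convention
    j_{s+1} = 0. *)
Definition jval (h : nat) : nat :=
  if (h < nb_parts)%N then part mu (index (dpart h) lam) else 0%N.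

Definition kval (h : nat) : nat := part nu (index (dpart h) lam).

(** [h == 0] accounts for the convention k_0 = oo. *)
Definition Jset : {set 'I_nb_parts} :=
  [set h : 'I_nb_parts |
    (jval h.+1 < jval h)%N && ((h == 0%N :> nat) || (kval h < kval h.-1)%N)].

Definition GLsize (h : 'I_nb_parts) : nat :=
  if h \in Jset then (mult h).-1 else mult h.

End DistinctParts.

(** A (quasi-affine) variety is a subset of a finite-dimensional vector space;
    maps between varieties are total functions of which only the values on the
    source matter. *)

Section Varieties.
Variable k : closedFieldType.

(** Regularity does not depend on the basis used for the coordinates. *)
Definition crd (W : vectType k) (w : W) (i : 'I_(\dim {:W})) : k :=
  coord (vbasis {:W}) i w.

Definition polyval (W : vectType k) (p : {mpoly k[\dim {:W}]}) (w : W) : k :=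
  p.@[crd w].

(** Regular functions are those that are locally, for the Zariski topology, a
    quotient of two polynomials; principal open sets form a basis. *)
Definition regular_fun (W : vectType k) (X : W -> Prop) (f : W -> k) : Prop :=
  forall w, X w -> exists p q : {mpoly k[\dim {:W}]},
    polyval q w != 0 /\
    forall w', X w' -> polyval q w' != 0 -> f w' = polyval p w' / polyval q w'.

Definition regular_map (W W' : vectType k) (X : W -> Prop) (Y : W' -> Prop)
    (phi : W -> W') : Prop :=
  (forall w, X w -> Y (phi w)) /\
  (forall i, regular_fun X (fun w => crd (phi w) i)).

Definition inverse_isos (W W' : vectType k) (X : W -> Prop) (Y : W' -> Prop)
    (phi : W -> W') (psi : W' -> W) : Prop :=
  [/\ regular_map X Y phi, regular_map Y X psi,
      forall w, X w -> psi (phi w) = w & forall w, Y w -> phi (psi w) = w].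

Definition variety_iso (W W' : vectType k) (X : W -> Prop) (Y : W' -> Prop) :
    Prop :=
  exists phi psi, inverse_isos X Y phi psi.

Definition affine_space (d : nat) : 'rV[k]_d -> Prop := fun _ => True.

Definition prod_variety (W W' : vectType k) (X : W -> Prop) (Y : W' -> Prop) :
    (W * W')%type -> Prop :=
  fun w => X w.1 /\ Y w.2.

Definition alg_group_iso (W W' : vectType k)
    (X : W -> Prop) (mulX : W -> W -> W)
    (Y : W' -> Prop) (mulY : W' -> W' -> W') : Prop :=
  exists phi psi, inverse_isos X Y phi psi /\
    forall a b, X a -> X b -> phi (mulX a b) = mulY (phi a) (phi b).

Definition GL (W : vectType k) : 'End(W) -> Prop := fun g => lker g == 0%VS.

Definition closed_subgroup (W : vectType k) (U : 'End(W) -> Prop) : Prop :=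
  [/\ forall g, U g -> GL g,
      U \1%VF,
      forall g h, U g -> U h -> U (g \o h)%VF,
      forall g, U g -> U (g^-1)%VF
    & exists E : {mpoly k[\dim {:'End(W)}]} -> Prop,
        forall g, GL g -> (U g <-> forall p, E p -> polyval p g = 0)].

Definition unipotent (W : vectType k) (U : 'End(W) -> Prop) : Prop :=
  forall g, U g -> exists m, forall w, iter m (g - \1)%VF w = 0.

(** The product of the groups GL_{r_h}(k), as block diagonal matrices.  For
    [r := GLsize] this is the product of the GL_{n_{l_h}-1}(k) with h in J and
    of the GL_{n_{l_h}}(k) with h not in J. *)
Definition GLprod (s : nat) (r : 'I_s -> nat) : 'M[k]_(\sum_h r h) -> Prop :=
  fun g => exists B : forall h, 'M[k]_(r h),
    (forall h, B h \in unitmx) /\ g = \mxdiag_h B h.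

Definition alg_action (m : nat) (W : vectType k) (H : 'M[k]_m -> Prop)
    (U : 'End(W) -> Prop) (alpha : 'M[k]_m -> 'End(W) -> 'End(W)) : Prop :=
  [/\ regular_map (prod_variety H U) U (fun p => alpha p.1 p.2),
      forall u, U u -> alpha 1%:M u = u,
      forall g h u, H g -> H h -> U u ->
        alpha (g *m h) u = alpha g (alpha h u)
    & forall h u u', H h -> U u -> U u' ->
        alpha h (u \o u')%VF = (alpha h u \o alpha h u')%VF].

Definition sdprod_mul (m : nat) (W : vectType k)
    (alpha : 'M[k]_m -> 'End(W) -> 'End(W)) (a b : ('End(W) * 'M[k]_m)%type) :
    ('End(W) * 'M[k]_m)%type :=
  ((a.1 \o alpha a.2 b.1)%VF, a.2 *m b.2).

End Varieties.

Section EnhancedCone.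
Variables (k : closedFieldType) (V : vectType k).

Definition nilpotent_end (x : 'End(V)) : Prop :=
  exists m, forall w, iter m x w = 0.

(** [e i j] is the vector usually written v_{i+1,j}: the row index starts at 0,
    the column index at 1. *)
Definition jordan_basis (x : 'End(V)) (lam : seq nat) (e : nat -> nat -> V) :
    Prop :=
  [/\ basis_of {:V} [seq e i j | i <- iota 0 (size lam), j <- iota 1 (part lam i)],
      forall i j, (i < size lam)%N -> (1 < j <= part lam i)%N ->
        x (e i j) = e i j.-1
    & forall i, (i < size lam)%N -> x (e i 1%N) = 0].

Definition enhanced_orbit (mu nu : seq nat) (v : V) (x : 'End(V)) : Prop :=
  nilpotent_end x /\
  exists e, jordan_basis x (addpart mu nu) e /\
    v = \sum_(i < size (addpart mu nu) | (0 < part mu i)%N) e i (part mu i).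

Definition stabiliser (v : V) (x : 'End(V)) : 'End(V) -> Prop :=
  fun g => GL g /\ (g v, (g \o x \o g^-1)%VF) = (v, x).

End EnhancedCone.

(* Main.v *)
Require Import Defs.
From HB Require Import structures.
From mathcomp Require Import all_boot all_order all_algebra.
From mathcomp Require Import mpoly.
From mathcomp Require Import zify.

Set Implicit Arguments.
Unset Strict Implicit.
Unset Printing Implicit Defensive.

Import GRing.Theory.

Local Open Scope ring_scope.

(** Regard V as a module over polynomials in x: a Jordan basis amounts to
    generators u_i = v_(i, lam_i) with x^(lam_i) u_i = 0 as only relations, the
    basis being the monomials x^s u_i with s < lam_i. In these terms the vector
    is v = sum_i x^(nu_i) u_i. If mu_i <= mu_r and nu_r <= nu_i, the term of i
    can be absorbed in that of r by adding x^(nu_i - nu_r) u_i to u_r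
    ([absorb]). Among the pairs (mu_i, nu_i) with mu_i > 0, each is dominated in
    this sense by a minimal one, and the minimal ones are the (j_h, k_h) with h in
    J. Hence there are generators with v = sum_(r in R) x^(nu_r) u_r, where R consists of
    one index in I_h for each h in J: the normal form of v.

    The endomorphisms commuting with x and fixing v form a monoid S, an affine
    subspace of End(V), whose units are the stabiliser. For g in S, the
    components of g u_i along the u_p, for i, p outside R with lam_i = lam_p,
    form a block diagonal matrix pi(g) with blocks of the sizes n_(l_h) - 1,
    h in J, and n_(l_h), h not in J. The map pi is multiplicative on S: a
    nonzero component through a generator with another part is excluded by
    x^(lam_i) u_i = 0, and one through R is excluded because g v = v forces
    g u_r to have the component 1 along u_r and no other one along generators
    with the same part ([coord_minimal], [levi_projM]). In the other direction a
    block diagonal matrix acts on the u_i with i outside R, and with the identity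
    on the u_r this gives a multiplicative section sigma of pi with values in S.

    So the stabiliser is the semidirect product of U = {g in S | pi(g) = 1} by
    the block diagonal matrices, through g = (g sigma(pi g)^-1) sigma(pi g)
    ([levi_decomposition]). U is unipotent as g - 1 strictly decreases a
    statistic on monomials ([nilpotent_kernel]). It is the translate by 1 of a
    linear subspace A, hence an affine space and closed. Finally dim A is
    counted in monomial coordinates ([dim_kernel]): the centraliser of x has
    dimension sum_(i, p) min(lam_i, lam_p) = b(mu; nu) + |mu|, the condition
    g v = v costs |mu|, and pi(g) = 1 costs the sum of the squares of the block
    sizes. *)

(** * Regular functions and regular maps *)

Section RegularFunctions.
Variable k : closedFieldType.
Implicit Types W : vectType k.

Definition regular_crds W W' (X : W -> Prop) (phi : W -> W') : Prop :=
  forall i, regular_fun X (fun w => crd (phi w) i).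

Lemma polyval_const W c (w : W) : polyval c%:MP w = c.
Proof. exact: mevalC. Qed.

Lemma polyvalD W p q (w : W) : polyval (p + q) w = polyval p w + polyval q w.
Proof. exact: mevalD. Qed.

Lemma polyvalM W p q (w : W) : polyval (p * q) w = polyval p w * polyval q w.
Proof. exact: mevalM. Qed.

Lemma regular_polyval W (X : W -> Prop) p : regular_fun X (polyval p).
Proof.
move=> w _; exists p, 1%:MP; split; first by rewrite polyval_const oner_neq0.
by move=> w' _ _; rewrite polyval_const divr1.
Qed.

Lemma eq_regular W (X : W -> Prop) (f g : W -> k) :
  (forall w, X w -> f w = g w) -> regular_fun X f -> regular_fun X g.
Proof.
move=> fg Rf w Xw; have [p [q [qw pq]]] := Rf w Xw.
by exists p, q; split=> // w' Xw' qw'; rewrite -fg // pq.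
Qed.

Lemma regular_const W (X : W -> Prop) c : regular_fun X (fun=> c).
Proof.
by apply: eq_regular _ (regular_polyval c%:MP) => w _; apply: polyval_const.
Qed.

Lemma regularD W (X : W -> Prop) (f g : W -> k) :
  regular_fun X f -> regular_fun X g -> regular_fun X (fun w => f w + g w).
Proof.
move=> Rf Rg w Xw; have [p [q [qw pq]]] := Rf w Xw.
have [p' [q' [qw' pq']]] := Rg w Xw; exists (p * q' + p' * q), (q * q').
split=> [|z Xz]; rewrite !polyvalM mulf_eq0 negb_or ?qw //.
by case/andP=> qz qz'; rewrite polyvalD !polyvalM pq // pq' // addf_div.
Qed.

Lemma regularM W (X : W -> Prop) (f g : W -> k) :
  regular_fun X f -> regular_fun X g -> regular_fun X (fun w => f w * g w).
Proof.
move=> Rf Rg w Xw; have [p [q [qw pq]]] := Rf w Xw.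
have [p' [q' [qw' pq']]] := Rg w Xw; exists (p * p'), (q * q').
split=> [|z Xz]; rewrite !polyvalM mulf_eq0 negb_or ?qw //.
by case/andP=> qz qz'; rewrite pq // pq' // mulf_div.
Qed.

(** Where f = p / q does not vanish, neither does p, and 1 / f is q^2 / (p q):
    the denominator p q keeps the neighbourhood on which f = p / q holds. *)
Lemma regularV W (X : W -> Prop) (f : W -> k) :
  (forall w, X w -> f w != 0) -> regular_fun X f ->
  regular_fun X (fun w => (f w)^-1).
Proof.
move=> f0 Rf w Xw; have [p [q [qw pq]]] := Rf w Xw.
exists (q * q), (p * q); split=> [|z Xz].
  rewrite polyvalM mulf_neq0 //; apply: contraNneq (f0 w Xw) => pw0.
  by rewrite pq // pw0 mul0r.
rewrite !polyvalM mulf_eq0 negb_or => /andP[pz qz].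
by rewrite pq // -mulf_div divff // mulr1 invf_div.
Qed.

Lemma regular_sum W (X : W -> Prop) (I : Type) (r : seq I) (P : pred I)
    (f : I -> W -> k) :
  (forall i, regular_fun X (f i)) ->
  regular_fun X (fun w => \sum_(i <- r | P i) f i w).
Proof.
move=> Rf; elim: r => [|i r IHr].
  by apply: eq_regular _ (regular_const 0) => w _; rewrite big_nil.
have [Pi|nPi] := boolP (P i).
  by apply: eq_regular _ (regularD (Rf i) IHr) => w _; rewrite big_cons Pi.
by apply: eq_regular _ IHr => w _; rewrite big_cons (negPf nPi).
Qed.

Lemma regular_prod W (X : W -> Prop) (I : Type) (r : seq I) (P : pred I)
    (f : I -> W -> k) :
  (forall i, regular_fun X (f i)) ->
  regular_fun X (fun w => \prod_(i <- r | P i) f i w).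
Proof.
move=> Rf; elim: r => [|i r IHr].
  by apply: eq_regular _ (regular_const 1) => w _; rewrite big_nil.
have [Pi|nPi] := boolP (P i).
  by apply: eq_regular _ (regularM (Rf i) IHr) => w _; rewrite big_cons Pi.
by apply: eq_regular _ IHr => w _; rewrite big_cons (negPf nPi).
Qed.

Lemma crdE W (w : W) : w = \sum_i crd w i *: (vbasis {:W})`_i.
Proof. by rewrite {1}(coord_vbasis (memvf w)). Qed.

Lemma linear_crdE W (W' : lmodType k) (f : W -> W') : linear f ->
  forall w, f w = \sum_i crd w i *: f (vbasis {:W})`_i.
Proof.
move=> lin_f w; pose fM := GRing.isLinear.Build _ _ _ _ f lin_f.
pose fL : {linear W -> W'} := HB.pack f fM.
rewrite -[f w]/(fL w) {1}(crdE w) linear_sum.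
by apply: eq_bigr => i _; rewrite linearZ.
Qed.

(** A linear form is given by a polynomial of degree one, hence regular; applied
    to a regular map it combines finitely many regular coordinates. *)
Lemma regular_scalar W W' (X : W -> Prop) (phi : W -> W') (f : W' -> k) :
  scalar f -> regular_crds X phi -> regular_fun X (fun w => f (phi w)).
Proof.
move=> lin_f Rphi.
apply: (@eq_regular _ _
    (fun w => \sum_i crd (phi w) i * f (vbasis {:W'})`_i)).
  by move=> w _; rewrite (@linear_crdE W' k^o f lin_f).
by apply: regular_sum => i; apply: regularM (regular_const _).
Qed.

Lemma scalar_crd W i : scalar (fun w : W => crd w i).
Proof. by move=> c u w; apply: coord_is_scalar. Qed.

Lemma regular_id W (X : W -> Prop) : regular_crds X id.
Proof.
move=> i; apply: eq_regular _ (regular_polyval 'X_i) => w _.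
exact: mevalXU.
Qed.

Lemma regular_linear W W1 W2 (X : W -> Prop) (phi : W -> W1) (f : W1 -> W2) :
  linear f -> regular_crds X phi -> regular_crds X (fun w => f (phi w)).
Proof.
move=> lin_f Rphi i.
apply: (@regular_scalar _ _ _ _ (fun w => crd (f w) i)) => // c u w.
by rewrite lin_f scalar_crd.
Qed.

(** Both coordinates are expanded on bases, so that the product becomes a
    polynomial in the coordinates of the factors. *)
Lemma regular_bilinear W W1 W2 W3 (X : W -> Prop) (phi : W -> W1)
    (psi : W -> W2) (B : W1 -> W2 -> W3) :
  (forall u, linear (B u)) -> (forall u, linear (B^~ u)) ->
  regular_crds X phi -> regular_crds X psi ->
  regular_crds X (fun w => B (phi w) (psi w)).
Proof.
move=> lin2 lin1 Rphi Rpsi i.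
apply: (@eq_regular _ _ (fun w => \sum_a \sum_b crd (phi w) a *
    (crd (psi w) b * crd (B (vbasis {:W1})`_a (vbasis {:W2})`_b) i))).
  move=> w _; have lin1i u : scalar (fun z => crd (B z u) i).
    by move=> c z z'; rewrite lin1 scalar_crd.
  have lin2i u : scalar (fun z => crd (B u z) i).
    by move=> c z z'; rewrite lin2 scalar_crd.
  rewrite [RHS](@linear_crdE _ k^o _ (lin1i _)); apply: eq_bigr => a _.
  by rewrite (@linear_crdE _ k^o _ (lin2i _)) scaler_sumr.
apply: regular_sum => a; apply: regular_sum => b; apply: regularM (Rphi a) _.
by apply: regularM (Rpsi b) (regular_const _).
Qed.

Lemma eq_regular_crds W W' (X : W -> Prop) (phi psi : W -> W') :
  (forall w, X w -> phi w = psi w) -> regular_crds X phi -> regular_crds X psi.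
Proof.
by move=> e Rphi i; apply: eq_regular _ (Rphi i) => w Xw; rewrite e.
Qed.

Lemma regular_cst W W' (X : W -> Prop) (c : W') : regular_crds X (fun=> c).
Proof. by move=> i; apply: regular_const. Qed.

Lemma regular_crdsD W W' (X : W -> Prop) (phi psi : W -> W') :
  regular_crds X phi -> regular_crds X psi ->
  regular_crds X (fun w => phi w + psi w).
Proof.
move=> Rphi Rpsi i; apply: eq_regular _ (regularD (Rphi i) (Rpsi i)) => w _.
by rewrite /crd linearD.
Qed.

Lemma regular_sum_scale W W' (X : W -> Prop) (I : Type) (r : seq I) (P : pred I)
    (f : I -> W -> k) (e : I -> W') : (forall i, regular_fun X (f i)) ->
  regular_crds X (fun w => \sum_(i <- r | P i) f i w *: e i).
Proof.
move=> Rf j.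
apply: (@eq_regular _ _ (fun w => \sum_(i <- r | P i) f i w * crd (e i) j)).
  by move=> w _; rewrite /crd linear_sum; apply: eq_bigr => i _; rewrite linearZ.
by apply: regular_sum => i; apply: regularM (regular_const _).
Qed.

Lemma regular_pair W W1 W2 (X : W -> Prop) (phi : W -> W1) (psi : W -> W2) :
  regular_crds X phi -> regular_crds X psi ->
  regular_crds X (fun w => (phi w, psi w)).
Proof.
move=> Rphi Rpsi.
have lin1 : linear (fun u : W1 => (u, 0 : W2)).
  by move=> c u w; congr (_, _); rewrite /= scaler0 addr0.
have lin2 : linear (fun u : W2 => (0 : W1, u)).
  by move=> c u w; congr (_, _); rewrite /= scaler0 addr0.
apply: eq_regular_crds _ (regular_crdsD (regular_linear lin1 Rphi)
                                      (regular_linear lin2 Rpsi)) => w _.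
by congr (_, _); rewrite /= ?addr0 ?add0r.
Qed.

Lemma regular_fst W1 W2 (X : (W1 * W2)%type -> Prop) :
  regular_crds X (fun w => w.1).
Proof. by apply: (@regular_linear _ _ _ _ id) (@regular_id _ _) => c u w. Qed.

Lemma regular_snd W1 W2 (X : (W1 * W2)%type -> Prop) :
  regular_crds X (fun w => w.2).
Proof. by apply: (@regular_linear _ _ _ _ id) (@regular_id _ _) => c u w. Qed.

Lemma regular_entry W (X : W -> Prop) m n (M : W -> 'M[k]_(m, n)) a b :
  regular_crds X M -> regular_fun X (fun w => M w a b).
Proof.
apply: (@regular_scalar _ _ _ _ (fun A : 'M_(m, n) => A a b)) => c A B.
by rewrite !mxE.
Qed.

Lemma regular_matrix W (X : W -> Prop) m n (M : W -> 'M[k]_(m, n)) :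
  (forall a b, regular_fun X (fun w => M w a b)) -> regular_crds X M.
Proof.
move=> RM; apply: (@eq_regular_crds _ _ _
    (fun w => \sum_(t : 'I_m * 'I_n) M w t.1 t.2 *: delta_mx t.1 t.2)).
  move=> w _; rewrite [RHS]matrix_sum_delta.
  by rewrite pair_bigA.
by apply: regular_sum_scale => -[a b]; apply: RM.
Qed.

Lemma regular_det W (X : W -> Prop) m (M : W -> 'M[k]_m) :
  (forall a b, regular_fun X (fun w => M w a b)) ->
  regular_fun X (fun w => \det (M w)).
Proof.
move=> RM; rewrite /determinant; apply: regular_sum => s.
by apply: regularM (regular_const _) _; apply: regular_prod => i.
Qed.

(** Cramer's rule: the entries of the inverse are minors divided by the
    determinant. *)
Lemma regular_invmx W (X : W -> Prop) m (M : W -> 'M[k]_m) :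
  (forall w, X w -> M w \in unitmx) -> regular_crds X M ->
  regular_crds X (fun w => invmx (M w)).
Proof.
move=> uM /regular_entry RM; apply: regular_matrix => a b.
apply: (@eq_regular _ _ (fun w => (\det (M w))^-1 *
    ((-1) ^+ (b + a) * \det (row' b (col' a (M w)))))).
  by move=> w Xw; rewrite /invmx uM // !mxE.
apply: regularM.
  by apply: regularV => [w /uM|]; [rewrite unitmxE unitfE | apply: regular_det].
apply: regularM (regular_const _) _; apply: regular_det => c d.
by apply: eq_regular _ (RM (lift b c) (lift a d)) => w _; rewrite !mxE.
Qed.

Lemma regular_comp W (V : vectType k) (X : W -> Prop) (f g : W -> 'End(V)) :
  regular_crds X f -> regular_crds X g ->
  regular_crds X (fun w => f w \o g w)%VF.
Proof.
apply: regular_bilinear => u c a b.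
  by rewrite comp_lfunDr comp_lfunZr.
by rewrite comp_lfunDl comp_lfunZl.
Qed.

End RegularFunctions.

Section AffineSubspaces.
Variables (k : closedFieldType) (W : vectType k) (A : {vspace W}) (o : W).

Lemma variety_iso_affine :
  variety_iso (fun w => w - o \in A) (@affine_space k (\dim A)).
Proof.
pose phi (w : W) := \row_i coord (vbasis A) i (w - o).
pose psi (r : 'rV[k]_(\dim A)) := o + \sum_i r 0 i *: (vbasis A)`_i.
exists phi, psi; split.
- split=> //; apply: regular_matrix => a b.
  apply: (@eq_regular _ _ _
      (fun w => coord (vbasis A) b w + coord (vbasis A) b (- o))).
    by move=> w _; rewrite mxE linearD.
  apply: regularD (regular_const _).
  apply: regular_scalar (@regular_id _ _ _).
  exact: coord_is_scalar.
- split=> [r _|].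
    rewrite /psi addrC addKr; apply: memv_suml => i _.
    by apply/memvZ/vbasis_mem/mem_nth; rewrite size_tuple.
  apply: regular_crdsD (regular_cst _) _; apply: regular_sum_scale => i.
  by apply: regular_entry (@regular_id _ _ _).
- move=> w wA; rewrite /psi -[RHS](subrK o) [RHS]addrC [in RHS](coord_vbasis wA).
  by congr (_ + _); apply: eq_bigr => i _; rewrite mxE.
- move=> r _; apply/rowP=> i; rewrite mxE /psi addrC addKr.
  by rewrite coord_sum_free // (basis_free (vbasisP A)).
Qed.

(** The linear equations of the subspace [A]: the coordinates of the component
    along a complement of [A]. *)
Lemma affine_polynomial_equations :
  exists E : {mpoly k[\dim {:W}]} -> Prop,
    forall w, w - o \in A <-> forall p, E p -> polyval p w = 0.
Proof.
pose c w := w - projv A w.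
have lin_c : linear c.
  by move=> a u w; rewrite /c linearP opprD addrACA -scalerN -scalerDr.
pose p (i : 'I_(\dim {:W})) : {mpoly k[\dim {:W}]} :=
  \sum_(j < \dim {:W}) crd (c (vbasis {:W})`_j) i *: 'X_j - (crd (c o) i)%:MP.
have pE i w : polyval (p i) w = crd (c (w - o)) i.
  have -> : c (w - o) = c w - c o.
    by rewrite /c linearB /= !opprD !opprK addrACA.
  rewrite /polyval mevalB mevalC /crd [RHS]linearB; congr (_ - _).
  rewrite (linear_crdE lin_c w) !linear_sum; apply: eq_bigr => j _ /=.
  by rewrite mevalZ mevalXU linearZ /= mulrC.
have cA w : (w \in A) = (c w == 0).
  rewrite subr_eq0; apply/idP/eqP => [/projv_id //|->]; exact: memv_proj.
exists (fun q => exists i, q = p i) => w; split=> [wA q [i ->]|E0].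
  by move: wA; rewrite pE cA => /eqP->; rewrite /crd linear0.
rewrite cA (crdE (c _)) big1 // => i _.
by rewrite -pE E0 ?scale0r //; exists i.
Qed.

End AffineSubspaces.

(** * Dimension counts *)

(** The family [d] is dual to the forms [psi] and lies in [A], so the forms map A
    onto the whole coordinate space; their common kernel in A is A0. *)
Lemma dim_dual_family (K : fieldType) (W : vectType K) (A A0 : {vspace W})
    (J : finType) (D : {pred J}) (psi : J -> W -> K) (d : J -> W) :
  (forall j, scalar (psi j)) ->
  (forall j, j \in D -> d j \in A) ->
  (forall i j, i \in D -> j \in D -> psi i (d j) = (i == j)%:R) ->
  (forall a, reflect (a \in A /\ forall j, j \in D -> psi j a = 0) (a \in A0)) ->
  \dim A = (\dim A0 + #|D|)%N.
Proof.
move=> lin_psi dA psi_d A0P.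
pose Phi a : 'rV[K]_#|D| := \row_i psi (enum_val i) a.
have lin_Phi : linear Phi by move=> c a b; apply/rowP=> i; rewrite !mxE lin_psi.
pose PhiM := GRing.isLinear.Build _ _ _ _ Phi lin_Phi.
pose PhiL : {linear _ -> _} := HB.pack Phi PhiM.
have PhiE a i : linfun PhiL a 0 i = psi (enum_val i) a by rewrite lfunE /= mxE.
rewrite -(limg_ker_dim (linfun PhiL) A); congr (_ + _)%N.
  congr (\dim _); apply/vspaceP=> a; rewrite memv_cap memv_ker.
  apply/andP/A0P=> [[Aa /eqP/rowP Phi0]|[Aa psi0]]; split=> //.
    by move=> j Dj; have:= Phi0 (enum_rank_in Dj j); rewrite PhiE enum_rankK_in ?mxE.
  by apply/eqP/rowP=> i; rewrite PhiE psi0 ?mxE // enum_valP.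
suff -> : (linfun PhiL @: A)%VS = fullv by rewrite dimvf dim_matrix; apply: mul1n.
apply/vspaceP=> r; rewrite memvf (row_sum_delta r); apply: memv_suml => i _.
apply: memvZ; suff -> : delta_mx 0 i = linfun PhiL (d (enum_val i)).
  by rewrite memv_img // dA // enum_valP.
apply/rowP=> j; rewrite PhiE mxE eqxx psi_d ?enum_valP //.
by rewrite (inj_eq enum_val_inj).
Qed.

Lemma linear_kernel (K : fieldType) (W W' : vectType K) (f : W -> W') :
  linear f -> exists A : {vspace W}, forall a, (a \in A) = (f a == 0).
Proof.
move=> lin_f; pose fM := GRing.isLinear.Build _ _ _ _ f lin_f.
pose fL : {linear _ -> _} := HB.pack f fM.
by exists (lker (linfun fL)) => a; rewrite memv_ker lfunE.
Qed.

Lemma card_range N a b : (b <= N)%N ->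
  (\sum_(s < N | a <= s < b) 1 = b - a)%N.
Proof.
move=> leN; rewrite -(big_mkord (fun s => a <= s < b)%N (fun=> 1%N)).
rewrite -(@big_nat_widen _ _ _ 0 b N (leq a)) //.
by rewrite -(@big_nat_widenl _ _ _ a 0 b xpredT) // sum_nat_const_nat muln1.
Qed.

(** * Endomorphisms commuting with a nilpotent *)

Section Power.
Variables (k : fieldType) (V : vectType k).
Implicit Types x a : 'End(V).

Definition xpow x (s : nat) : 'End(V) := iter s (comp_lfun x) \1%VF.

Lemma xpow0 x w : xpow x 0 w = w. Proof. exact: id_lfunE. Qed.

Lemma xpowS x s w : xpow x s.+1 w = x (xpow x s w).
Proof. exact: comp_lfunE. Qed.

Lemma xpowD x s t w : xpow x (s + t) w = xpow x s (xpow x t w).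
Proof. by elim: s => [|s IHs]; rewrite ?xpow0 // addSn !xpowS IHs. Qed.

Lemma xpow_iter x s w : xpow x s w = iter s x w.
Proof. by elim: s => [|s IHs]; rewrite ?xpow0 // xpowS IHs. Qed.

Definition commutes x a : Prop := forall w, a (x w) = x (a w).

Lemma commutes_xpow x a s w :
  commutes x a -> a (xpow x s w) = xpow x s (a w).
Proof. by move=> xa; elim: s => [|s IHs]; rewrite ?xpow0 // !xpowS xa IHs. Qed.

Lemma commutesP x a : reflect (commutes x a) ((a \o x)%VF - (x \o a)%VF == 0).
Proof.
rewrite subr_eq0; apply: (iffP eqP) => [/lfunP xa w|xa].
  by have:= xa w; rewrite !comp_lfunE.
by apply/lfunP=> w; rewrite !comp_lfunE.
Qed.

End Power.

Section Generators.
Variables (k : fieldType) (V : vectType k) (x : 'End(V)).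
Variables (l : nat) (lam : 'I_l -> nat) (u : 'I_l -> V).
Variable F : 'I_l -> nat -> {scalar V}.

(** The vectors [u i] generate V as a module over polynomials in x, freely up
    to the relations x^(lam i) u i = 0; [F p s] is the coordinate along
    x^s u p. *)
Definition jordan_generators : Prop :=
  [/\ forall i, xpow x (lam i) (u i) = 0,
      forall p t i s, (s < lam i)%N ->
        F p t (xpow x s (u i)) = ((p == i) && (t == s))%:R
    & forall y, y = \sum_p \sum_(s < lam p) F p s y *: xpow x s (u p)].

Hypothesis gens : jordan_generators.
Hypothesis lam_gt0 : forall i, (0 < lam i)%N.

Lemma xpow_gen0 i s : (lam i <= s)%N -> xpow x s (u i) = 0.
Proof. by move/subnK <-; rewrite xpowD; case: gens => -> _ _; apply: linear0. Qed.

Lemma coord_gen p t i s :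
  F p t (xpow x s (u i)) = [&& p == i, t == s & (s < lam i)%N]%:R.
Proof.
have [s_lt|s_ge] := ltnP; first by case: gens => _ -> // _; rewrite andbT.
by rewrite xpow_gen0 // !andbF linear0.
Qed.

Lemma coord_xpow p t s y :
  F p t (xpow x s y) = if (s <= t < lam p)%N then F p (t - s)%N y else 0.
Proof.
have [_ _ expand] := gens; rewrite {1}(expand y) linear_sum linear_sum.
rewrite (bigD1 p) //= [X in _ + X]big1 => [|q neq_qp]; last first.
  rewrite linear_sum linear_sum big1 // => s' _.
  by rewrite !linearZ /= -xpowD coord_gen eq_sym (negPf neq_qp) mulr0.
rewrite addr0 linear_sum linear_sum; case: ifP => [/andP[le_st lt_t]|nst].
  have lt' : (t - s < lam p)%N by rewrite (leq_ltn_trans (leq_subr _ _)).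
  rewrite (bigD1 (Ordinal lt')) //= big1 => [|s' neq_s'].
    by rewrite !linearZ /= -xpowD coord_gen subnKC // !eqxx lt_t mulr1 addr0.
  rewrite !linearZ /= -xpowD coord_gen eqxx; case: eqP => [ts|]; last first.
    by rewrite mulr0.
  by case/eqP: neq_s'; apply: val_inj; rewrite /= ts addKn.
rewrite big1 // => s' _; rewrite !linearZ /= -xpowD coord_gen eqxx.
case: eqP => [ts|_]; last by rewrite mulr0.
by move: nst; rewrite ts leq_addr /= => ->; rewrite mulr0.
Qed.

(** Multiplication by x^m shifts the coordinates of index s < lam p - m to
    s + m without losing them. *)
Lemma coord_killed p s m y : xpow x m y = 0 -> (s + m < lam p)%N -> F p s y = 0.
Proof.
move=> y0 lt_sm; have := coord_xpow p (s + m) m y.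
by rewrite leq_addl lt_sm addnK y0 linear0.
Qed.

Lemma coord_inj y : (forall p s, (s < lam p)%N -> F p s y = 0) -> y = 0.
Proof.
have [_ _ expand] := gens; move=> F0; rewrite (expand y) big1 // => p _.
by rewrite big1 // => s _; rewrite F0 ?scale0r.
Qed.

Lemma eq_gen (W : vectType k) (f g : 'Hom(V, W)) :
  (forall i s, (s < lam i)%N -> f (xpow x s (u i)) = g (xpow x s (u i))) -> f = g.
Proof.
have [_ _ expand] := gens; move=> fg; apply/lfunP=> y; rewrite (expand y).
rewrite !linear_sum; apply: eq_bigr => p _; rewrite !linear_sum.
by apply: eq_bigr => s _; rewrite !linearZ /= fg.
Qed.

Lemma eq_commuting a b : commutes x a -> commutes x b ->
  (forall i, a (u i) = b (u i)) -> a = b.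
Proof. by move=> xa xb ab; apply: eq_gen => i s _; rewrite !commutes_xpow ?ab. Qed.

Section Elementary.
Variables (i p : 'I_l) (s : nat).

Let E0 y := \sum_(t < lam i) F i t y *: xpow x (t + s) (u p).

Fact E0_linear : linear E0.
Proof.
move=> c y z; rewrite /E0 scaler_sumr -big_split /=; apply: eq_bigr => t _.
by rewrite linearP scalerDl scalerA.
Qed.
HB.instance Definition _ := GRing.isLinear.Build k V V _ E0 E0_linear.

(** The analogue of a matrix unit. It commutes with x only when x^(lam i) kills
    x^s u p. *)
Definition elem : 'End(V) := linfun E0.

Lemma elem_gen j t : elem (xpow x t (u j)) =
  if (i == j) && (t < lam i)%N then xpow x (t + s) (u p) else 0.
Proof.
rewrite lfunE /= /E0; case: ifP => [/andP[/eqP<- lt_t]|nt].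
  rewrite (bigD1 (Ordinal lt_t)) //= big1 => [|t' neq_t'].
    by rewrite coord_gen !eqxx lt_t scale1r addr0.
  rewrite coord_gen eqxx; case: eqP => [tt|]; last by rewrite scale0r.
  by case/eqP: neq_t'; apply: val_inj.
rewrite big1 // => t' _; rewrite coord_gen.
case: (i =P j) nt => [<- nt|_ _]; last by rewrite scale0r.
by case: eqP nt => [-> /= ->|_ _]; rewrite ?andbF scale0r.
Qed.

Lemma elem_commutes : (lam p <= s + lam i)%N -> commutes x elem.
Proof.
move=> le_p; apply/commutesP; rewrite subr_eq0; apply/eqP.
apply: eq_gen => j t lt_t; rewrite !comp_lfunE -xpowS !elem_gen.
case: eqP => [ij|] /=; last by rewrite linear0.
move: lt_t; rewrite -ij => lt_t; rewrite lt_t -xpowS; case: ltnP => [//|le_t].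
by rewrite xpow_gen0 // (leq_trans le_p) // -addSn addnC leq_add2r.
Qed.

End Elementary.

Lemma elem_u i p s j : elem i p s (u j) = if i == j then xpow x s (u p) else 0.
Proof. by rewrite -[u j](xpow0 x) elem_gen lam_gt0 andbT. Qed.

(** A commuting endomorphism is determined by the images of the generators,
    subject to x^(lam i) (a (u i)) = 0, which bounds below the exponents of the
    monomials x^s u p that occur in a (u i). *)
Lemma coord_commuting a i p s : commutes x a -> (s + lam i < lam p)%N ->
  F p s (a (u i)) = 0.
Proof.
move=> xa; apply: coord_killed; rewrite -commutes_xpow //.
by case: gens => -> _ _; apply: linear0.
Qed.

End Generators.

(** * Normal form of the vector and projection to block diagonal matrices *)

Section NormalForm.
Variables (k : fieldType) (V : vectType k) (x : 'End(V)).
Variables (l : nat) (mu nu : 'I_l -> nat) (u : 'I_l -> V).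
Variable F : 'I_l -> nat -> {scalar V}.
Let lam i := (mu i + nu i)%N.
Variables (R : {set 'I_l}) (rho : 'I_l -> 'I_l).
Variables (m : nat) (theta : 'I_m -> 'I_l).

Hypothesis gens : jordan_generators x lam u F.
Hypothesis lam_gt0 : forall i, (0 < lam i)%N.
Hypothesis mono : forall p r, (nu r < nu p)%N -> (mu r <= mu p)%N.
Hypothesis R_mu : forall r, r \in R -> (0 < mu r)%N.
Hypothesis R_anti : forall r r', r \in R -> r' \in R ->
  (mu r <= mu r')%N -> (nu r' <= nu r)%N -> r = r'.
Hypothesis rhoP : forall p, (0 < mu p)%N ->
  [/\ rho p \in R, (mu p <= mu (rho p))%N & (nu (rho p) <= nu p)%N].
Hypothesis theta_inj : injective theta.
Hypothesis theta_R : forall a, theta a \notin R.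
Hypothesis theta_onto : forall p, p \notin R -> exists a, theta a = p.

Definition normal_vector : V := \sum_(r in R) xpow x (nu r) (u r).
Local Notation v := normal_vector.
Local Notation E := (elem x lam u F).
Local Notation same a b := (lam (theta a) == lam (theta b)).

Lemma coord_normal_vector a p s : commutes x a -> (s < lam p)%N ->
  F p s (a v) = \sum_(r in R | (nu r <= s)%N) F p (s - nu r) (a (u r)).
Proof.
move=> xa lt_s; rewrite /v linear_sum linear_sum big_mkcondr.
apply: eq_bigr => r _ /=; rewrite commutes_xpow // (coord_xpow gens) lt_s andbT.
by case: ifP.
Qed.

Lemma elem_normal_vector i p s :
  E i p s v = if i \in R then xpow x (nu i + s) (u p) else 0.
Proof.
rewrite linear_sum; case: ifP => [Ri|nRi].
  rewrite (bigD1 i) //= big1 => [|r /andP[_ neq_r]].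
    have nu_lt : (nu i < lam i)%N by have := R_mu Ri; rewrite /lam; lia.
    by rewrite (elem_gen gens) eqxx nu_lt addr0.
  by rewrite (elem_gen gens) eq_sym (negPf neq_r).
rewrite big1 //= => r Rr; rewrite (elem_gen gens).
by case: eqP => // ir; rewrite -ir nRi in Rr.
Qed.

(** Compare the coefficients of x^(nu r) u p in a v = c v: as r is minimal, only
    the generator [u r] contributes to the left-hand side. The scalar c covers
    both the group (c = 1) and its tangent space (c = 0). *)
Lemma coord_minimal a c r p : commutes x a -> a v = c *: v -> r \in R ->
  lam p = lam r -> F p 0%N (a (u r)) = if p == r then c else 0.
Proof.
move=> xa av Rr lam_pr.
have nu_lt : (nu r < lam p)%N by have := R_mu Rr; rewrite lam_pr /lam; lia.
have one b : commutes x b -> F p (nu r) (b v) = F p 0%N (b (u r)).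
  move=> xb; rewrite coord_normal_vector // (bigD1 r) /= ?Rr ?leqnn // subnn.
  rewrite big1 ?addr0 // => r' /andP[/andP[Rr' le_nu] neq_r].
  apply: (coord_commuting gens) => //; rewrite lam_pr /lam.
  have : ~~ (mu r <= mu r')%N.
    by apply: contraNN neq_r => le_mu; rewrite (R_anti Rr Rr').
  by lia.
have x1 : commutes x \1%VF by move=> w; rewrite !id_lfunE.
rewrite -one // av linearZ /= -[in LHS](id_lfunE v) one // id_lfunE.
rewrite -[u r](xpow0 x) (coord_gen gens) lam_gt0 andbT.
by case: eqP; rewrite ?mulr1 ?mulr0.
Qed.

(** The image of [a] in the reductive quotient. The parameter [theta] numbers
    the indices outside R, block by block. *)
Definition levi_proj (a : 'End(V)) : 'M[k]_m :=
  \matrix_(p, i) if same p i then F (theta p) 0%N (a (u (theta i))) else 0.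

Lemma sum_outside_R (W : nmodType) (f : 'I_l -> W) :
  \sum_(p | p \notin R) f p = \sum_c f (theta c).
Proof.
transitivity (\sum_(p in theta @: setT) f p).
  apply: eq_bigl => p; apply/idP/imsetP => [/theta_onto[c <-]|[c _ ->]] //.
  by exists c.
rewrite big_imset => [|a b _ _]; last exact: theta_inj.
by apply: eq_bigl => c; rewrite inE.
Qed.

(** The endomorphism acting by M on the generators outside R and fixing the
    others, hence fixing v. It commutes with x when M is block diagonal. *)
Definition levi_section (M : 'M[k]_m) : 'End(V) :=
  \sum_(r in R) E r r 0 +
  \sum_(t : 'I_m * 'I_m) M t.1 t.2 *: E (theta t.2) (theta t.1) 0.

Definition block_diag (M : 'M[k]_m) : Prop := forall p i, ~~ same p i -> M p i = 0.

Lemma levi_proj_block a : block_diag (levi_proj a).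
Proof. by move=> p i /negPf npi; rewrite mxE npi. Qed.

Lemma levi_proj_linear : linear levi_proj.
Proof.
move=> c a b; apply/matrixP=> p i; rewrite !mxE; case: ifP => _.
  by rewrite add_lfunE scale_lfunE linearP.
by rewrite mulr0 addr0.
Qed.

Lemma levi_proj1 : levi_proj \1%VF = 1%:M.
Proof.
apply/matrixP=> p i; rewrite !mxE id_lfunE -[u _](xpow0 x) (coord_gen gens).
rewrite lam_gt0 andbT (inj_eq theta_inj); case: (p =P i) => [->|].
  by rewrite eqxx.
by case: ifP.
Qed.

Definition fixes_xv (a : 'End(V)) : Prop := commutes x a /\ a v = v.

(** Expand [b (u i)] on monomials x^s u q and apply [a]. A term with s > 0 has
    no component along [u p]; a nonzero component of [b (u i)] along [u q] needs
    lam q <= lam i, and one of [a (u q)] along [u p] needs lam p <= lam q; the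
    terms with q in R vanish by [coord_minimal]. What is left is the matrix
    product. *)
Lemma levi_projM a b : fixes_xv a -> fixes_xv b ->
  levi_proj (a \o b)%VF = levi_proj a *m levi_proj b.
Proof.
move=> [xa av] [xb bv]; apply/matrixP=> p i; rewrite !mxE.
case: ifP => [lam_pi|npi]; last first.
  rewrite big1 // => c _; rewrite !mxE.
  have [pc|_] := eqVneq; last by rewrite mul0r.
  by rewrite -pc npi mulr0.
have [_ _ expand] := gens.
rewrite comp_lfunE {1}(expand (b (u (theta i)))) linear_sum linear_sum.
rewrite (bigID (mem R)) /= [X in X + _]big1 ?add0r => [|r Rr]; last first.
  rewrite linear_sum linear_sum big1 // => s _; rewrite !linearZ /=.
  rewrite commutes_xpow // (coord_xpow gens).
  case: ifP => [/andP[]|]; last by rewrite mulr0.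
  rewrite leqn0 => /eqP-> _; rewrite sub0n.
  have [eq_r|] := eqVneq (lam r) (lam (theta p)).
    rewrite (@coord_minimal a 1) ?scale1r //.
    case: eqP => [e|_]; last by rewrite mulr0.
    by move: (theta_R p); rewrite e Rr.
  rewrite neq_ltn => /orP[lt|gt].
    by rewrite (coord_commuting gens xa) ?mulr0.
  by rewrite (coord_commuting gens xb) ?mul0r // -(eqP lam_pi).
rewrite sum_outside_R; apply: eq_bigr => c _; rewrite !mxE.
rewrite linear_sum linear_sum (bigD1 (Ordinal (lam_gt0 _))) //= big1 => [|s].
  rewrite addr0 !linearZ /= (xpow0 x) [RHS]mulrC.
  have [eq_c|] := eqVneq (lam (theta p)) (lam (theta c)).
    by rewrite -eq_c lam_pi.
  rewrite mulr0 neq_ltn => /orP[lt|gt].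
    by rewrite (coord_commuting gens xb) ?mul0r // -(eqP lam_pi).
  by rewrite [X in _ * X](coord_commuting gens xa) ?mulr0.
rewrite -val_eqE /= -lt0n => s_gt0.
rewrite !linearZ /= commutes_xpow // (coord_xpow gens).
by rewrite [(s <= 0)%N]leqNgt s_gt0 mulr0.
Qed.

Lemma levi_section_u M i : i \in R -> levi_section M (u i) = u i.
Proof.
move=> Ri; rewrite add_lfunE !sum_lfunE (bigD1 i) //= big1 => [|r /andP[_ nri]].
  rewrite (elem_u gens) // eqxx (xpow0 x) big1 ?addr0 // => -[p j] _ /=.
  rewrite scale_lfunE (elem_u gens) //; case: eqP => [e|]; last by rewrite scaler0.
  by move: (theta_R j); rewrite e Ri.
by rewrite (elem_u gens) // (negPf nri).
Qed.

Lemma levi_section_theta M i :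
  levi_section M (u (theta i)) = \sum_p M p i *: u (theta p).
Proof.
rewrite add_lfunE !sum_lfunE [X in X + _]big1 => [|r Rr]; last first.
  rewrite (elem_u gens) //; case: eqP => // e.
  by move: (theta_R i); rewrite -e Rr.
rewrite add0r -(pair_bigA _
  (fun p j => (M p j *: E (theta j) (theta p) 0) (u (theta i)))) /=.
apply: eq_bigr => p _; rewrite (bigD1 i) //= big1 => [|j nji].
  by rewrite scale_lfunE (elem_u gens) // eqxx (xpow0 x) addr0.
by rewrite scale_lfunE (elem_u gens) // (inj_eq theta_inj) (negPf nji) scaler0.
Qed.

Lemma levi_section_commutes M : block_diag M -> commutes x (levi_section M).
Proof.
move=> blk w; rewrite !add_lfunE !sum_lfunE linearD !linear_sum.
congr (_ + _).
  apply: eq_bigr => r _ /=.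
  by rewrite (elem_commutes gens) // add0n.
apply: eq_bigr => -[p i] _ /=.
rewrite !scale_lfunE; have [e|/blk->] := boolP (same p i); last first.
  by rewrite !scale0r linear0.
by rewrite linearZ /= (elem_commutes gens) // add0n (eqP e).
Qed.

Lemma levi_section_fixes M : block_diag M -> fixes_xv (levi_section M).
Proof.
move=> blk; have xM := levi_section_commutes blk; split=> //.
rewrite linear_sum; apply: eq_bigr => r Rr /=.
by rewrite commutes_xpow // levi_section_u.
Qed.

Lemma levi_section1 : levi_section 1%:M = \1%VF.
Proof.
have blk1 : block_diag 1%:M.
  by move=> p i npi; rewrite mxE; case: (p =P i) npi => [->|]; rewrite ?eqxx.
apply: (eq_commuting gens); first exact: levi_section_commutes.
  by move=> w; rewrite !id_lfunE.
move=> i; rewrite id_lfunE; have [Ri|/theta_onto[c <-]] := boolP (i \in R).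
  by rewrite levi_section_u.
rewrite levi_section_theta (bigD1 c) //= big1 => [|p npc].
  by rewrite mxE eqxx scale1r addr0.
by rewrite mxE (negPf npc) scale0r.
Qed.

Lemma block_diagM M N : block_diag M -> block_diag N -> block_diag (M *m N).
Proof.
move=> bM bN p i npi; rewrite mxE big1 // => c _.
have [e|/bM->] := boolP (same p c); last by rewrite mul0r.
by rewrite bN ?mulr0 // -(eqP e).
Qed.

Lemma levi_sectionM M N : block_diag M -> block_diag N ->
  levi_section (M *m N) = (levi_section M \o levi_section N)%VF.
Proof.
move=> bM bN; have bMN := block_diagM bM bN.
have xM := levi_section_commutes bM; have xN := levi_section_commutes bN.
apply: (eq_commuting gens); first exact: levi_section_commutes.
  by move=> w; rewrite !comp_lfunE xN xM.
move=> i; rewrite comp_lfunE; have [Ri|/theta_onto[c <-]] := boolP (i \in R).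
  by rewrite !levi_section_u.
rewrite !levi_section_theta linear_sum /=.
under [RHS]eq_bigr => p _ do rewrite linearZ /= levi_section_theta scaler_sumr.
rewrite exchange_big /=; apply: eq_bigr => q _.
by rewrite mxE scaler_suml; apply: eq_bigr => p _; rewrite scalerA mulrC.
Qed.

Lemma levi_sectionK M : block_diag M -> levi_proj (levi_section M) = M.
Proof.
move=> bM; apply/matrixP=> p i; rewrite mxE.
have [e|/bM->//] := boolP (same p i).
rewrite levi_section_theta linear_sum (bigD1 p) //= big1 => [|q nqp].
  by rewrite linearZ /= -[u _](xpow0 x) (coord_gen gens) !eqxx lam_gt0 mulr1 addr0.
rewrite linearZ /= -[u _](xpow0 x) (coord_gen gens) (inj_eq theta_inj).
by rewrite eq_sym (negPf nqp) mulr0.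
Qed.

(** Such an endomorphism sends each monomial x^s u i to a combination of
    monomials of smaller rank for a lexicographic order: first by height
    lam i - s, which commutation with x prevents from increasing; at equal
    height the block can only get longer; at equal length the new generator is
    in R and the old one is not. *)
Lemma nilpotent_kernel a : commutes x a -> a v = 0 -> levi_proj a = 0 ->
  exists N, forall w, iter N a w = 0.
Proof.
move=> xa av pa; pose L := (\sum_i lam i)%N.
have lam_le i : (lam i <= L)%N by rewrite /L (bigD1 i) //= leq_addr.
have av' : a v = 0 *: v by rewrite av scale0r.
(* The lexicographic order, encoded in base 2 (L + 1). *)
pose rk (i : 'I_l) s := ((lam i - s) * L.+1.*2 + (L - lam i).*2 + (i \notin R))%N.
have [_ _ expand] := gens.
have killed N : forall i s, (s < lam i)%N -> (rk i s < N)%N ->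
    xpow a N (xpow x s (u i)) = 0.
  elim: N => // N IHN i s lt_s rkN; rewrite -addn1 xpowD xpowS xpow0.
  rewrite commutes_xpow // (expand (a (u i))) !linear_sum big1 // => p _.
  rewrite !linear_sum big1 // => t _; rewrite !linearZ /= -xpowD.
  have [le_p|gt_p] := leqP (lam p) (s + t).
    by rewrite (xpow_gen0 gens) // linear0 scaler0.
  have [/(coord_commuting gens xa)->|le_t] := ltnP (t + lam i) (lam p).
    by rewrite scale0r.
  have lt_rk : (rk p (s + t) < rk i s)%N \/ F p t (a (u i)) = 0.
    have [Lp Li] := (lam_le p, lam_le i).
    have [t_gt|t_le] := ltnP (lam p) (t + lam i).
      left; rewrite /rk.
      have : ((lam p - (s + t)).+1 * L.+1.*2 <= (lam i - s) * L.+1.*2)%N.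
        by rewrite leq_mul2r; lia.
      by rewrite mulSn; case: (p \in R); case: (i \in R); lia.
    have e : ((lam p - (s + t)) * L.+1.*2 = (lam i - s) * L.+1.*2)%N.
      by congr (_ * _)%N; lia.
    have [lam_gt|lam_le'] := ltnP (lam i) (lam p).
      by left; rewrite /rk; case: (p \in R); case: (i \in R); lia.
    have lam_eq : lam p = lam i by lia.
    have -> : t = 0%N :> nat by lia.
    have [Ri|nRi] := boolP (i \in R).
      by right; rewrite (coord_minimal xa av') // if_same.
    have [Rp|nRp] := boolP (p \in R).
      by left; rewrite /rk Rp nRi; lia.
    have [[c ec] [d ed]] := (theta_onto nRp, theta_onto nRi).
    right; have := congr1 (fun M : 'M_m => M c d) pa.
    by rewrite !mxE ec ed lam_eq eqxx.
  case: lt_rk => [lt_rk|->]; last by rewrite scale0r.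
  by rewrite IHN ?scaler0 // -ltnS (leq_trans _ rkN).
pose B := (\sum_i \sum_(s < lam i) (rk i s).+1)%N; exists B => w.
rewrite -xpow_iter (expand w) linear_sum big1 // => p _.
rewrite linear_sum big1 // => s _; rewrite linearZ /= killed ?scaler0 //.
by rewrite /B (bigD1 p) //= (bigD1 s) //= -addnA leq_addr.
Qed.

Lemma commutator_linear : linear (fun a : 'End(V) => (a \o x)%VF - (x \o a)%VF).
Proof.
move=> c a b; rewrite comp_lfunDl comp_lfunDr -comp_lfunZl -comp_lfunZr.
by rewrite opprD addrACA scalerBr.
Qed.

(** A descending chain of three subspaces, each cut out by coordinate forms with
    a dual family of elementary endomorphisms. A commuting [a] has free
    coordinates along x^s u p in [a (u i)] for lam p <= s + lam i; the
    coordinates of [a v] along x^s u p are free for s >= nu p, being reached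
    from the generator [u (rho p)], and zero for s < nu p; the entries of
    [levi_proj a] are free, as they involve only generators outside R. *)
Lemma dim_kernel : exists A : {vspace 'End(V)},
  (forall a, [/\ commutes x a, a v = 0 & levi_proj a = 0] <-> a \in A) /\
  (\sum_i \sum_p minn (lam i) (lam p) =
    \dim A + \sum_i \sum_p same p i + \sum_p mu p)%N.
Proof.
pose comm a := ((a \o x)%VF - (x \o a)%VF : 'End(V)).
have lin_ev w : linear (fun a : 'End(V) => a w).
  by move=> c a b; rewrite add_lfunE scale_lfunE.
have [C CP] := linear_kernel commutator_linear.
have [|B BP] := @linear_kernel _ _ _ (fun a => (comm a, a v)).
  by move=> c a b; rewrite /comm commutator_linear lin_ev.
have [|A AP] := @linear_kernel _ _ _ (fun a => (comm a, (a v, levi_proj a))).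
  by move=> c a b; rewrite /comm commutator_linear lin_ev levi_proj_linear.
have inC a : reflect (commutes x a) (a \in C) by rewrite CP; apply: commutesP.
have inB a : reflect (commutes x a /\ a v = 0) (a \in B).
  rewrite BP; apply: (iffP andP) => [[/commutesP xa /eqP]|[xa av]]; first by split.
  by split; [apply/commutesP | apply/eqP].
have inA a : reflect [/\ commutes x a, a v = 0 & levi_proj a = 0] (a \in A).
  rewrite AP; apply: (iffP and3P) => [[/commutesP xa /eqP av /eqP]|[xa av pa]].
    by split.
  by split; [apply/commutesP | apply/eqP | apply/eqP].
exists A; split=> [a|]; first exact: rwP (inA a).
pose N := (\sum_i lam i)%N.
have leN i : (lam i <= N)%N by rewrite /N (bigD1 i) //= leq_addr.
have coord_u p t i : F p t (u i) = ((p == i) && (t == 0%N))%:R.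
  by rewrite -[u i](xpow0 x) (coord_gen gens) lam_gt0 andbT.
pose T := [pred t : 'I_l * 'I_l * 'I_N |
             (lam t.1.2 - lam t.1.1 <= t.2 < lam t.1.2)%N].
have dimC : \dim C = #|T|.
  rewrite (@dim_dual_family _ _ C 0 _ T
    (fun t a => F t.1.2 t.2 (a (u t.1.1))) (fun t => E t.1.1 t.1.2 t.2)).
  - by rewrite dimv0.
  - by case=> -[i p] s c a b; rewrite lin_ev linearP.
  - case=> -[i p] s; rewrite inE /= => /andP[le_s _]; apply/inC.
    by apply: (elem_commutes gens); lia.
  - case=> -[i p] s [[j q] t]; rewrite !inE /= => /andP[_ lt_s] /andP[_ lt_t].
    rewrite (elem_u gens) // !xpair_eqE /= [j == i]eq_sym.
    case: (i == j); last by rewrite linear0.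
    by rewrite (coord_gen gens) lt_t andbT.
  - move=> a; rewrite memv0; apply: (iffP eqP) => [->|[/inC xa a0]].
      split=> [|[[i p] s] _]; first exact: mem0v.
      by rewrite zero_lfunE linear0.
    apply: (eq_commuting gens) => // [w|i]; rewrite !zero_lfunE ?linear0 //.
    apply: (coord_inj gens) => p s lt_s.
    have lt_sN : (s < N)%N := leq_trans lt_s (leN p).
    have [/(coord_commuting gens xa)//|le_s] := ltnP (s + lam i) (lam p).
    by apply: (a0 (i, p, Ordinal lt_sN)); rewrite inE /=; lia.
pose P := [pred t : 'I_l * 'I_N | (nu t.1 <= t.2 < lam t.1)%N].
have dimCB : \dim C = (\dim B + #|P|)%N.
  have mu_gt0 p s : (nu p <= s)%N -> (s < lam p)%N -> (0 < mu p)%N.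
    by rewrite /lam; lia.
  apply: (@dim_dual_family _ _ C B _ P (fun t a => F t.1 t.2 (a v))
            (fun t => E (rho t.1) t.1 (t.2 - nu (rho t.1)))).
  - by case=> p s c a b; rewrite lin_ev linearP.
  - case=> p s; rewrite inE /= => /andP[le_s lt_s]; apply/inC.
    have [_ le_mu le_nu] := rhoP (mu_gt0 _ _ le_s lt_s).
    by apply: (elem_commutes gens); rewrite /lam; lia.
  - case=> p s [q t]; rewrite !inE /= => /andP[_ lt_s] /andP[le_t lt_t].
    have [Rr le_mu le_nu] := rhoP (mu_gt0 _ _ le_t lt_t).
    rewrite elem_normal_vector Rr subnKC; last exact: leq_trans le_nu le_t.
    by rewrite (coord_gen gens) lt_t andbT xpair_eqE.
  - move=> a; apply: (iffP (inB a)) => [[xa av]|[/inC xa av0]].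
      by split=> [|t _]; [apply/inC | rewrite av linear0].
    split=> //; apply: (coord_inj gens) => p s lt_s.
    have lt_sN : (s < N)%N := leq_trans lt_s (leN p).
    have [le_s|gt_s] := leqP (nu p) s.
      by apply: (av0 (p, Ordinal lt_sN)); rewrite inE /= le_s.
    rewrite coord_normal_vector // big1 // => r /andP[Rr le_r].
    apply: (coord_commuting gens) => //.
    by have := mono (leq_ltn_trans le_r gt_s); rewrite /lam; lia.
pose Q := [pred t : 'I_m * 'I_m | same t.1 t.2].
have dimBA : \dim B = (\dim A + #|Q|)%N.
  apply: (@dim_dual_family _ _ B A _ Q
            (fun t a => F (theta t.1) 0%N (a (u (theta t.2))))
            (fun t => E (theta t.2) (theta t.1) 0)).
  - by case=> p i c a b; rewrite lin_ev linearP.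
  - case=> p i; rewrite inE /= => /eqP e; apply/inB; split.
      by apply: (elem_commutes gens); rewrite e.
    by rewrite elem_normal_vector (negPf (theta_R i)).
  - case=> p i [q j] _ _; rewrite (elem_u gens) // (xpow0 x) xpair_eqE /=.
    rewrite (inj_eq theta_inj) [j == i]eq_sym; case: (i == j).
      by rewrite coord_u (inj_eq theta_inj).
    by rewrite linear0 andbF.
  - move=> a; apply: (iffP (inA a)) => [[xa av pa]|[/inB[xa av] a0]].
      split=> [|[p i]]; first exact/inB.
      rewrite inE /= => e; have := congr1 (fun M : 'M_m => M p i) pa.
      by rewrite !mxE e.
    split=> //; apply/matrixP=> p i; rewrite !mxE; case: ifP => // e.
    exact: (a0 (p, i)).
have cardT : #|T| = (\sum_i \sum_p minn (lam i) (lam p))%N.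
  rewrite -sum1_card -(pair_big_dep xpredT
    (fun (t : 'I_l * 'I_l) (s : 'I_N) => (lam t.2 - lam t.1 <= s < lam t.2)%N)
    (fun _ _ => 1%N)) /=.
  rewrite pair_bigA; apply: eq_bigr => -[i p] _ /=.
  by rewrite card_range // minnE; lia.
have cardP : #|P| = (\sum_p mu p)%N.
  rewrite -sum1_card -(pair_big_dep xpredT
    (fun p (s : 'I_N) => (nu p <= s < lam p)%N) (fun _ _ => 1%N)) /=.
  by apply: eq_bigr => p _; rewrite card_range // /lam addnK.
have cardQ : #|Q| = (\sum_i \sum_p same p i)%N.
  rewrite exchange_big pair_bigA -sum1_card big_mkcond.
  by apply: eq_bigr => -[p i] _; rewrite inE /=; case: (same p i).
by rewrite -cardT -dimC dimCB dimBA cardP cardQ.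
Qed.

End NormalForm.

(** * Block diagonal matrices *)

Section BlockDiagonal.
Variables (k : closedFieldType) (s : nat) (r : 'I_s -> nat).
Local Notation m := (\sum_h r h)%N.
Local Notation H := (@GLprod k s r).

Lemma invmxM n (A B : 'M[k]_n) : A \in unitmx -> B \in unitmx ->
  invmx (A *m B) = invmx B *m invmx A.
Proof.
move=> uA uB; have uAB : A *m B \in unitmx by rewrite unitmx_mul uA.
rewrite -[RHS](mulKmx uAB) -!mulmxA (mulmxA B) mulmxV // mul1mx mulmxV //.
by rewrite mulmx1.
Qed.

Lemma mxdiagM (B C : forall h, 'M[k]_(r h)) :
  \mxdiag_h B h *m \mxdiag_h C h = \mxdiag_h (B h *m C h).
Proof.
rewrite mul_mxdiag_mxblock; apply/eq_mxblockP => i j.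
by case: eqP => [<-|_]; rewrite ?conform_mx_id ?mulmx0.
Qed.

Lemma mxdiag_unit (B : forall h, 'M[k]_(r h)) : (forall h, B h \in unitmx) ->
  \mxdiag_h B h *m \mxdiag_h invmx (B h) = 1%:M.
Proof.
move=> uB; rewrite mxdiagM -(@mxdiagZ _ _ r 1); apply/eq_mxdiagP => h.
exact: mulmxV.
Qed.

(** For the converse, the block of index h of g g^-1 = 1 shows that the diagonal
    block of g is invertible. *)
Lemma GLprodP (g : 'M[k]_m) : H g <->
  g \in unitmx /\ forall a b, tagnat.sig1 a != tagnat.sig1 b -> g a b = 0.
Proof.
split=> [[B [uB ->]]|[ug g0]].
  split; first by have /mulmx1_unit[] := mxdiag_unit uB.
  by move=> a b /negPf nab; rewrite !mxE nab mxE.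
pose B h := submxblock g h h.
have gB : g = \mxdiag_h B h.
  rewrite -[LHS]submxblockK; apply/eq_mxblockP => i j.
  case: eqP => [<-|/eqP nij]; first by rewrite conform_mx_id.
  by apply/matrixP=> a b; rewrite !mxE g0 // !tagnat.Rank1K.
exists B; split=> // h; have := mulmxV ug.
rewrite {1}gB -[invmx g]submxblockK mul_mxdiag_mxblock -(@mxdiagZ _ _ r 1).
move=> /(congr1 (fun M => submxblock M h h)).
by rewrite submxblock_diag mxblockK => /mulmx1_unit[].
Qed.

Lemma GLprodV g : H g -> H (invmx g).
Proof.
move=> [B [uB gE]]; exists (fun h => invmx (B h)); split=> [h|].
  by rewrite unitmx_inv.
have ug : g \in unitmx by rewrite gE; case/mulmx1_unit: (mxdiag_unit uB).
by rewrite -[RHS](mulKmx ug) [in X in _ *m X]gE mxdiag_unit // mulmx1.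
Qed.

End BlockDiagonal.

(** * Levi decomposition of the stabiliser *)

Section Levi.
Variables (k : closedFieldType) (V : vectType k) (x : 'End(V)).
Variables (l : nat) (mu nu : 'I_l -> nat) (u : 'I_l -> V).
Variable F : 'I_l -> nat -> {scalar V}.
Let lam i := (mu i + nu i)%N.
Variables (R : {set 'I_l}).
Variables (s : nat) (r : 'I_s -> nat) (theta : 'I_(\sum_h r h) -> 'I_l).

Hypothesis gens : jordan_generators x lam u F.
Hypothesis lam_gt0 : forall i, (0 < lam i)%N.
Hypothesis R_mu : forall r, r \in R -> (0 < mu r)%N.
Hypothesis R_anti : forall r r', r \in R -> r' \in R ->
  (mu r <= mu r')%N -> (nu r' <= nu r)%N -> r = r'.
Hypothesis theta_inj : injective theta.
Hypothesis theta_R : forall a, theta a \notin R.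
Hypothesis theta_onto : forall p, p \notin R -> exists a, theta a = p.
Hypothesis theta_lam : forall a b,
  (lam (theta a) == lam (theta b)) = (tagnat.sig1 a == tagnat.sig1 b).

Local Notation v := (normal_vector x nu u R).
Local Notation pi := (levi_proj mu nu u F theta).
Local Notation sigma := (levi_section x mu nu u F R theta).
Local Notation fixes := (fixes_xv x nu u R).
Local Notation H := (@GLprod k s r).

Variable A : {vspace 'End(V)}.
Hypothesis inA : forall a, [/\ commutes x a, a v = 0 & pi a = 0] <-> a \in A.

Let U (g : 'End(V)) : Prop := g - \1%VF \in A.

Lemma GL_of_inverse (g h : 'End(V)) : (h \o g = \1)%VF -> GL g.
Proof.
move=> hg; rewrite /GL -subv0; apply/subvP=> w; rewrite memv_ker memv0 => /eqP gw.
by rewrite -[w]id_lfunE -hg comp_lfunE gw linear0.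
Qed.

Lemma GLVr (g : 'End(V)) : GL g -> (g \o g^-1 = \1)%VF.
Proof. exact: lker0_compfV. Qed.

Lemma GLVl (g : 'End(V)) : GL g -> (g^-1 \o g = \1)%VF.
Proof. exact: lker0_compVf. Qed.

Lemma fixesM g h : fixes g -> fixes h -> fixes (g \o h)%VF.
Proof.
move=> [xg gv] [xh hv]; split=> [w|]; last by rewrite comp_lfunE hv.
by rewrite !comp_lfunE xh xg.
Qed.

Lemma fixesV g : GL g -> fixes g -> fixes (g^-1)%VF.
Proof.
move=> Gg [xg gv].
have gK w : (g^-1)%VF (g w) = w by rewrite -comp_lfunE GLVl // id_lfunE.
split=> [w|]; last by rewrite -[in LHS]gv gK.
by rewrite -[w in LHS]id_lfunE -(GLVr Gg) comp_lfunE -xg gK.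
Qed.

Lemma stabiliserP g : stabiliser v x g <-> GL g /\ fixes g.
Proof.
split=> [[Gg [gv xg]]|[Gg [xg gv]]]; split=> //.
  split=> // w; rewrite -[in RHS]xg !comp_lfunE.
  by rewrite -[(g^-1)%VF (g w)]comp_lfunE GLVl // id_lfunE.
rewrite gv; congr (_, _); apply/lfunP=> w; rewrite !comp_lfunE xg.
by rewrite -[g _]comp_lfunE GLVr // id_lfunE.
Qed.

Lemma sub_lfunE (f g : 'End(V)) w : (f - g)%VF w = f w - g w.
Proof. by rewrite add_lfunE opp_lfunE. Qed.

Lemma in_U g : U g <-> fixes g /\ pi g = 1%:M.
Proof.
have piB a b : pi (a - b) = pi a - pi b.
  have lin := @levi_proj_linear _ _ _ mu nu u F _ theta.
  by rewrite -scaleN1r addrC lin scaleN1r addrC.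
have pi1 : pi \1%VF = 1%:M by apply: (levi_proj1 gens).
split=> [/inA[xg gv pg]|[[xg gv] pg]].
  split; last by apply/eqP; rewrite -subr_eq0 -pi1 -piB pg.
  split=> [w|]; last first.
    by apply/eqP; rewrite -subr_eq0; move/eqP: gv; rewrite sub_lfunE id_lfunE.
  have:= xg w; rewrite !sub_lfunE !id_lfunE linearB /= => /(congr1 (+%R^~ (x w))).
  by rewrite !subrK.
apply/inA; split=> [w||].
- by rewrite !sub_lfunE !id_lfunE linearB xg.
- by rewrite sub_lfunE id_lfunE gv subrr.
- by rewrite piB pi1 pg subrr.
Qed.

Lemma U_unipotent : unipotent U.
Proof.
move=> g /inA[xg gv pg].
exact: (nilpotent_kernel gens lam_gt0 R_mu R_anti theta_onto xg gv pg).
Qed.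

Lemma U_GL g : U g -> GL g.
Proof.
move=> /U_unipotent[N gN]; rewrite /GL -subv0; apply/subvP=> w.
rewrite memv_ker memv0 => /eqP gw.
have iterE n : iter n (g - \1)%VF w = (-1) ^+ n *: w.
  elim: n => [|n IHn]; first by rewrite scale1r.
  rewrite /= IHn linearZ /= sub_lfunE gw id_lfunE sub0r exprS.
  by rewrite mulN1r scaleNr scalerN.
by have /eqP := gN w; rewrite iterE scaler_eq0 signr_eq0.
Qed.

Lemma block_diagP (M : 'M[k]_(\sum_h r h)) : block_diag mu nu theta M <->
  forall a b, tagnat.sig1 a != tagnat.sig1 b -> M a b = 0.
Proof. by split=> blk a b nab; apply: blk; rewrite theta_lam in nab *. Qed.

Lemma GLprod_block M : H M -> block_diag mu nu theta M.
Proof. by move=> /GLprodP[_ M0]; apply/block_diagP. Qed.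

Lemma sigma_fixes M : H M -> fixes (sigma M).
Proof. by move=> /GLprod_block; apply: levi_section_fixes. Qed.

Lemma sigmaM M N : H M -> H N -> sigma (M *m N) = (sigma M \o sigma N)%VF.
Proof. by move=> /GLprod_block bM /GLprod_block; apply: levi_sectionM. Qed.

Lemma GLprod_unit (M : 'M[k]_(\sum_h r h)) : H M -> M \in unitmx.
Proof. by case/GLprodP. Qed.

Lemma sigmaV M : H M -> (sigma M \o sigma (invmx M) = \1)%VF.
Proof.
move=> HM; rewrite -sigmaM //; last exact: GLprodV.
by rewrite mulmxV ?GLprod_unit //; apply: (levi_section1 gens).
Qed.

Lemma sigmaVl M : H M -> (sigma (invmx M) \o sigma M = \1)%VF.
Proof. by move=> HM; have := sigmaV (GLprodV HM); rewrite invmxK. Qed.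

Lemma piM g h : fixes g -> fixes h -> pi (g \o h)%VF = pi g *m pi h.
Proof. exact: levi_projM. Qed.

Lemma pi_sigma M : H M -> pi (sigma M) = M.
Proof. by move=> /GLprod_block; apply: levi_sectionK. Qed.

Lemma pi_GL g : GL g -> fixes g -> H (pi g).
Proof.
move=> Gg fg; apply/GLprodP; split.
  have := piM fg (fixesV Gg fg); rewrite GLVr // (levi_proj1 gens) //.
  by move=> /esym/mulmx1_unit[].
by apply/block_diagP; apply: levi_proj_block.
Qed.

Lemma U_closed_subgroup : closed_subgroup U.
Proof.
split.
- exact: U_GL.
- by rewrite /U subrr mem0v.
- move=> g h /in_U[fg pg] /in_U[fh ph]; apply/in_U; split; first exact: fixesM.
  by rewrite piM // pg ph mulmx1.
- move=> g Ug; have Gg := U_GL Ug; case/in_U: Ug => fg pg.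
  have fV := fixesV Gg fg; apply/in_U; split=> //.
  by rewrite -[LHS]mul1mx -pg -piM // GLVr // (levi_proj1 gens).
- have [E EP] := affine_polynomial_equations A \1%VF.
  by exists E => g _; apply: EP.
Qed.

Definition levi_conj (M : 'M[k]_(\sum_h r h)) (g : 'End(V)) : 'End(V) :=
  (sigma M \o g \o sigma (invmx M))%VF.

Lemma regular_sigma (W : vectType k) (X : W -> Prop) M :
  regular_crds X M -> regular_crds X (fun w => sigma (M w)).
Proof.
move=> RM; apply: regular_crdsD (regular_cst _) _; apply: regular_sum_scale => t.
exact: regular_entry RM.
Qed.

Lemma levi_conj_U M g : H M -> U g -> U (levi_conj M g).
Proof.
move=> HM /in_U[fg pg]; have HV := GLprodV HM.
have [fM fV] := (sigma_fixes HM, sigma_fixes HV).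
have fMg := fixesM fM fg; apply/in_U; split; first exact: fixesM.
by rewrite !piM // !pi_sigma // pg mulmx1 mulmxV ?GLprod_unit.
Qed.

Lemma levi_conj_action : alg_action H U levi_conj.
Proof.
split.
- split=> [[M g] [/= HM Ug]|]; first exact: levi_conj_U.
  apply: regular_comp; first apply: regular_comp.
  + exact/regular_sigma/regular_fst.
  + exact: regular_snd.
  + apply/regular_sigma/regular_invmx => [[M g] [/GLprod_unit]|] //=.
    exact: regular_fst.
- move=> g _; rewrite /levi_conj invmx1 (levi_section1 gens) //.
  by rewrite comp_lfun1l comp_lfun1r.
- move=> M N g HM HN _; rewrite /levi_conj sigmaM //.
  have [uM uN] := (GLprod_unit HM, GLprod_unit HN).
  rewrite invmxM // sigmaM; [|exact: GLprodV..].
  by rewrite !comp_lfunA.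
- move=> M g h HM _ _; rewrite /levi_conj !comp_lfunA.
  rewrite -(comp_lfunA _ (sigma (invmx M)) (sigma M)) sigmaVl //.
  by rewrite comp_lfun1r.
Qed.

(** The isomorphism is g |-> (g sigma(pi g)^-1, pi g), with inverse
    (u, M) |-> u sigma(M). *)
Lemma levi_decomposition :
  alg_group_iso (stabiliser v x) (fun g h => (g \o h)%VF)
                (prod_variety U H) (sdprod_mul levi_conj).
Proof.
pose phi (g : 'End(V)) := ((g \o sigma (invmx (pi g)))%VF, pi g).
pose psi (w : 'End(V) * 'M[k]_(\sum_h r h)) := (w.1 \o sigma w.2)%VF.
have Rpi : regular_crds (stabiliser v x) (fun g => pi g).
  apply: (@regular_linear _ _ _ _ _ id); first exact: levi_proj_linear.
  exact: regular_id.
exists phi, psi; split; first split.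
- split=> [g /stabiliserP[Gg fg]|].
    have Hg := pi_GL Gg fg; have HV := GLprodV Hg.
    split=> //=; apply/in_U; have fV := sigma_fixes HV.
    split; first exact: fixesM.
    by rewrite piM // pi_sigma // mulmxV ?GLprod_unit.
  apply: regular_pair (Rpi); apply: regular_comp (@regular_id _ _ _) _.
  apply/regular_sigma/regular_invmx => [g stab_g|]; last exact: Rpi.
  have [Gg fg] := (stabiliserP g).1 stab_g.
  exact: GLprod_unit (pi_GL Gg fg).
- split=> [[g M] [/= Ug HM]|]; last first.
    apply: regular_comp; first exact: regular_fst.
    exact/regular_sigma/regular_snd.
  have Gg := U_GL Ug; have [fg _] := (in_U g).1 Ug; apply/stabiliserP.
  split; last by apply: fixesM => //; apply: sigma_fixes.
  apply: (@GL_of_inverse _ (sigma (invmx M) \o g^-1)%VF).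
  rewrite /psi /= comp_lfunA -(comp_lfunA _ _ g) GLVl // comp_lfun1r.
  exact: sigmaVl.
- move=> g /stabiliserP[Gg fg]; rewrite /psi /= -comp_lfunA.
  by rewrite sigmaVl ?comp_lfun1r //; apply: pi_GL.
- move=> [g M] [/= /in_U[fg pg] HM]; rewrite /phi /psi /=.
  have -> : pi (g \o sigma M)%VF = M.
    by rewrite piM ?pg ?mul1mx ?pi_sigma //; apply: sigma_fixes.
  by rewrite -comp_lfunA sigmaV // comp_lfun1r.
move=> g h /stabiliserP[Gg fg] /stabiliserP[Gh fh].
have [Hg Hh] := (pi_GL Gg fg, pi_GL Gh fh).
have [ug uh] := (GLprod_unit Hg, GLprod_unit Hh).
rewrite /phi /sdprod_mul /= piM //; congr (_, _).
rewrite invmxM // sigmaM; [|exact: GLprodV..].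
rewrite /levi_conj !comp_lfunA.
rewrite -(comp_lfunA _ (sigma (invmx (pi g))) (sigma (pi g))) sigmaVl //.
by rewrite comp_lfun1r.
Qed.

End Levi.

(** * A Jordan basis adapted to the vector *)

Section AdaptedBasis.
Variables (k : fieldType) (V : vectType k) (x : 'End(V)).
Variables (l : nat).

(** The monomials are as many as the dimension, so it is enough that they span;
    spanning is expressed through all subspaces containing them, a form in which
    it passes easily from one family of generators to another. *)
Lemma jordan_generators_exist (lam : 'I_l -> nat) (u : 'I_l -> V) :
  (forall i, xpow x (lam i) (u i) = 0) ->
  (\sum_i lam i = \dim {:V})%N ->
  (forall Y : {vspace V}, (forall i s, xpow x s (u i) \in Y) -> Y = fullv) ->
  exists F, jordan_generators x lam u F.
Proof.
move=> u0 dimV gen_u.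
pose X := [tuple xpow x (tagnat.sig2 a) (u (tagnat.sig1 a)) | a < \sum_i lam i].
have XE (a : 'I_(\sum_i lam i)%N) : X`_a = xpow x (tagnat.sig2 a) (u (tagnat.sig1 a)).
  by rewrite -tnth_nth tnth_mktuple.
have XR i (s : 'I_(lam i)) : X`_(tagnat.Rank i s) = xpow x s (u i).
  rewrite XE; have := tagnat.rankK (Tagged (fun i => 'I_(lam i)) s).
  by rewrite /tagnat.sig1 /tagnat.sig2 => ->.
have basisX : basis_of fullv X.
  rewrite basisEdim size_tuple -[X in (_ <= X)%N]dimV leqnn andbT.
  rewrite (gen_u <<X>>%VS) ?subvv // => i s.
  have [le_s|lt_s] := leqP (lam i) s.
    by rewrite -(subnK le_s) xpowD u0 linear0 mem0v.
  rewrite -[s]/(val (Ordinal lt_s)) -XR; apply: memv_span.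
  by apply: mem_nth; rewrite size_tuple.
clearbody X.
(* The sum has one term if t < lam p and none otherwise. *)
pose f p t y :=
  \sum_(a | (tagnat.sig1 a == p) && (tagnat.sig2 a == t :> nat)) coord X a y.
have lin_f p t : scalar (f p t).
  move=> c y z; rewrite /f mulr_sumr -big_split; apply: eq_bigr => a _.
  exact: coord_is_scalar.
pose F p t : {scalar V} :=
  HB.pack (f p t) (GRing.isLinear.Build k V k _ (f p t) (lin_f p t)).
have FR p (s : 'I_(lam p)) y : F p s y = coord X (tagnat.Rank p s) y.
  rewrite /F /= /f (big_pred1 (tagnat.Rank p s)) // => a /=.
  by have := tagnat.eq_Rank (tagnat.sig2 a) s; rewrite tagnat.sig2K => <-.
have FX p t i (s : 'I_(lam i)) :
    F p t (xpow x s (u i)) = ((p == i) && (t == s))%:R.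
  rewrite -XR -[LHS]/(f p t _) /f.
  rewrite (eq_bigr (fun a => (tagnat.Rank i s == a)%:R)) => [|a _]; last first.
    by rewrite coord_free ?(basis_free basisX).
  have sigR : tagnat.sig (tagnat.Rank i s) = Tagged _ s by apply: tagnat.rankK.
  rewrite big_mkcond (bigD1 (tagnat.Rank i s)) //= eqxx big1 => [|a neq_a].
    rewrite addr0 /tagnat.sig1 /tagnat.sig2 sigR /= [i == p]eq_sym.
    by rewrite [_ == t]eq_sym; case: ifP.
  by rewrite [tagnat.Rank i s == a]eq_sym (negPf neq_a) if_same.
exists F; split=> // [p t i s lt_s|y]; first exact: (FX p t i (Ordinal lt_s)).
rewrite [LHS](coord_basis basisX (memvf y)).
under [RHS]eq_bigr => p _ do under eq_bigr => s _ do rewrite FR -XR.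
rewrite sig_big_dep (reindex _ tagnat.sig_bij_on).
by apply: eq_bigr => a _; rewrite -tagnat.rankE tagnat.sigK.
Qed.

Variables (mu nu : 'I_l -> nat) (R : {set 'I_l}) (rho : 'I_l -> 'I_l).
Let lam i := (mu i + nu i)%N.
Hypothesis rhoP : forall p, (0 < mu p)%N ->
  [/\ rho p \in R, (mu p <= mu (rho p))%N & (nu (rho p) <= nu p)%N].

Variable u : 'I_l -> V.
Hypothesis u0 : forall i, xpow x (lam i) (u i) = 0.

(** Each term x^(nu j) u j of the vector with j outside R is absorbed in a
    generator [u r], r = rho j, as x^(nu r) x^(nu j - nu r) u j; the new generator
    is still killed by x^(lam r) because mu j <= mu r. *)
Definition absorb i :=
  if i \in R then
    u i + \sum_(j | (j \notin R) && (0 < mu j)%N && (rho j == i))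
            xpow x (nu j - nu i) (u j)
  else u i.

Lemma absorb_killed i : xpow x (lam i) (absorb i) = 0.
Proof.
rewrite /absorb; case: ifP => // _; rewrite linearD /= u0 add0r linear_sum.
rewrite big1 // => j /andP[/andP[_ mu_gt0] /eqP ji] /=.
have [_ le_mu le_nu] := rhoP mu_gt0; rewrite ji in le_mu le_nu.
have -> : xpow x (lam i) (xpow x (nu j - nu i) (u j)) =
          xpow x (mu i - mu j) (xpow x (lam j) (u j)).
  by rewrite -!xpowD; congr (xpow x _ _); rewrite /lam; lia.
by rewrite u0 linear0.
Qed.

Lemma absorb_normal_vector :
  \sum_i xpow x (nu i) (u i) = normal_vector x nu absorb R.
Proof.
rewrite /normal_vector (bigID (mem R)) /=.
rewrite [RHS](eq_bigr (fun i => xpow x (nu i) (u i) +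
    \sum_(j | (j \notin R) && (0 < mu j)%N && (rho j == i)) xpow x (nu j) (u j))).
  rewrite [RHS]big_split /=; congr (_ + _).
  rewrite (bigID (fun j => 0 < mu j)%N) /= [X in _ + X]big1 => [|j /andP[_]].
    rewrite addr0 (partition_big rho (mem R)) //= => j /andP[_ mu_gt0].
    by case: (rhoP mu_gt0).
  by rewrite -eqn0Ngt => /eqP mu0; have := u0 j; rewrite /lam mu0.
move=> i Ri; rewrite /absorb Ri linearD linear_sum; congr (_ + _).
apply: eq_bigr => j /andP[/andP[_ mu_gt0] /eqP ji] /=.
have [_ _ le_nu] := rhoP mu_gt0; rewrite ji in le_nu.
by rewrite -xpowD subnKC.
Qed.

Lemma absorb_generates (Y : {vspace V}) :
  (forall i s, xpow x s (absorb i) \in Y) -> forall i s, xpow x s (u i) \in Y.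
Proof.
move=> absY i s; have outY j t : j \notin R -> xpow x t (u j) \in Y.
  by move=> /negPf nRj; have := absY j t; rewrite /absorb nRj.
have [Ri|/outY//] := boolP (i \in R); have := absY i s.
rewrite /absorb Ri linearD /= rpredDr // linear_sum.
by apply: memv_suml => j /andP[/andP[nRj _] _]; rewrite /= -xpowD outY.
Qed.

End AdaptedBasis.

(** * Combinatorics of bipartitions *)

Section SortedSequences.
Implicit Types (s : seq nat) (z i h : nat).

Lemma geq_trans : transitive geq.
Proof. by move=> b a c ab bc; apply: leq_trans bc ab. Qed.

Lemma sorted_part s i j : sorted geq s -> (i <= j)%N -> (part s j <= part s i)%N.
Proof.
move=> srt le_ij; have [le_j|lt_j] := leqP (size s) j.
  by rewrite /part nth_default.
apply: (sorted_leq_nth geq_trans leqnn 0%N srt) => //.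
by rewrite inE (leq_ltn_trans le_ij).
Qed.

Lemma nth_sorted_eq s z i : sorted geq s -> z \in s -> (i < size s)%N ->
  (nth 0%N s i == z) = (index z s <= i < index z s + count_mem z s)%N.
Proof.
elim: s i z => // a s IHs i z srt; have srt' := path_sorted srt.
rewrite inE /=; have [<- _|neq_az /= zs] := eqVneq a z.
  case: i => [|i]; first by rewrite /= eqxx.
  rewrite add0n !ltnS /= => lt_i; have [as_|nas] := boolP (a \in s).
    rewrite IHs //; suff -> : index a s = 0%N by [].
    case: s as_ srt {IHs srt' lt_i} => //= b s; rewrite inE.
    case: eqVneq => [//|nab] /=.
    move=> as_ /andP[le_ba]; rewrite (path_sortedE geq_trans).
    case/andP=> /allP/(_ a as_) le_ab _; case/eqP: nab.
    by apply/eqP; rewrite eqn_leq; apply/andP; split.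
  rewrite (count_memPn nas); apply: contraNF nas => /eqP <-.
  exact: mem_nth.
case: i => [_|i]; first by rewrite /= (negPf neq_az).
by rewrite ltnS => lt_i /=; rewrite IHs.
Qed.

Lemma index_count_le s z : (index z s + count_mem z s <= size s)%N.
Proof.
elim: s => //= a s IHs; case: eqP => _; first by rewrite !add0n ltnS count_size.
by rewrite addSn ltnS add0n.
Qed.

Section Blocks.
Variable s : seq nat.
Hypothesis srt : sorted geq s.
Let d := nth 0%N (undup s).

Lemma distinct_in h : (h < size (undup s))%N -> d h \in s.
Proof. by move=> lt_h; rewrite -mem_undup mem_nth. Qed.

Lemma distinct_le h h' : (h <= h')%N -> (d h' <= d h)%N.
Proof.
apply: sorted_part; apply: subseq_sorted (undup_subseq s) srt.
exact: geq_trans.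
Qed.

Lemma distinct_eq h h' : (h < size (undup s))%N -> (h' < size (undup s))%N ->
  (d h == d h') = (h == h').
Proof. by move=> lt_h lt_h'; rewrite nth_uniq ?undup_uniq. Qed.

Lemma block_eq h i : (h < size (undup s))%N -> (i < size s)%N ->
  (nth 0%N s i == d h) = (index (d h) s <= i < index (d h) s + count_mem (d h) s)%N.
Proof. by move=> lt_h; apply: nth_sorted_eq srt (distinct_in lt_h). Qed.

(** The distinct values of a non-increasing sequence occupy consecutive
    intervals. *)
Lemma next_block h : (h < size (undup s))%N ->
  (index (d h) s + count_mem (d h) s =
   if h.+1 < size (undup s) then index (d h.+1) s else size s)%N.
Proof.
move=> lt_h; set i := (_ + _)%N; have le_i : (i <= size s)%N := index_count_le _ _.
(* An entry that follows the block of d h is d h' for some h' > h. *)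
have after j : (i <= j < size s)%N ->
    exists h', [/\ (h < h')%N, (h' < size (undup s))%N & nth 0%N s j = d h'].
  case/andP=> le_ij lt_j; pose z := nth 0%N s j.
  have zu : z \in undup s by rewrite mem_undup mem_nth.
  exists (index z (undup s)); rewrite index_mem zu /d nth_index //.
  split=> //; rewrite ltnNge; apply/negP => /distinct_le.
  rewrite /d nth_index // => le_z.
  have le_fj : (index (d h) s <= j)%N by rewrite (leq_trans _ le_ij) ?leq_addr.
  have := sorted_part srt le_fj; rewrite /part nth_index ?distinct_in // => ge_z.
  have := block_eq lt_h lt_j; rewrite [_ == _](_ : _ = true).
    by rewrite le_fj ltnNge -/i le_ij.
  by rewrite eqn_leq ge_z.
case: ifP => [lt_h1|/negbT]; last first.
  rewrite -leqNgt => ge_h1; apply/eqP; rewrite eqn_leq le_i leqNgt.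
  apply/negP => lt_i; have [|h' [lt_hh' lt_h' _]] := after i; first by rewrite leqnn.
  by move: (leq_trans lt_h' ge_h1); rewrite ltnS leqNgt lt_hh'.
set j := index _ _; have lt_j : (j < size s)%N by rewrite index_mem distinct_in.
have sj : nth 0%N s j = d h.+1 by rewrite nth_index ?distinct_in.
have le_ij : (i <= j)%N.
  rewrite leqNgt; apply/negP => lt_ji; have := block_eq lt_h lt_j.
  rewrite sj distinct_eq // -/i lt_ji andbT gtn_eqF // => /esym/negbT.
  rewrite -ltnNge => /ltnW/(sorted_part srt); rewrite /part sj.
  rewrite nth_index ?distinct_in // => ge_d.
  have := distinct_eq lt_h lt_h1; rewrite eqn_leq ge_d distinct_le //.
  by rewrite ltn_eqF.
apply/eqP; rewrite eqn_leq le_ij leqNgt; apply/negP => lt_ij.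
have lt_i := leq_ltn_trans le_ij lt_j.
have [|h' [lt_hh' lt_h' si]] := after i; first by rewrite leqnn.
have : nth 0%N s i == d h.+1.
  rewrite eqn_leq {1}si distinct_le //=.
  by have := sorted_part srt le_ij; rewrite /part sj.
by rewrite block_eq // leqNgt lt_ij.
Qed.

End Blocks.

End SortedSequences.

Section Bipartitions.
Variables mu nu : seq nat.
Hypotheses (mu_part : is_partition mu) (nu_part : is_partition nu).
Local Notation lam := (addpart mu nu).
Local Notation l := (size lam).

Lemma size_addpart : l = maxn (size mu) (size nu).
Proof. by rewrite size_mkseq. Qed.

Lemma part_addpart i : part lam i = (part mu i + part nu i)%N.
Proof.
rewrite {1}/part; have [le_i|lt_i] := leqP l i; last first.
  by rewrite nth_mkseq -?size_addpart.
rewrite nth_default //; move: le_i; rewrite size_addpart geq_max /part.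
by case/andP=> le_mu le_nu; rewrite !nth_default.
Qed.

Lemma part_gt0 (s : seq nat) i : is_partition s -> (0 < part s i)%N = (i < size s)%N.
Proof.
case/andP=> _ s0; have [le_i|lt_i] := leqP (size s) i.
  by rewrite /part nth_default.
by rewrite lt0n; apply: contraNneq s0 => <-; apply: mem_nth.
Qed.

Lemma addpart_gt0 (i : 'I_l) : (0 < part mu i + part nu i)%N.
Proof.
have := ltn_ord i; rewrite [X in (_ < X)%N -> _]size_addpart leq_max addn_gt0.
by rewrite !part_gt0.
Qed.

Lemma mu_le i j : (i <= j)%N -> (part mu j <= part mu i)%N.
Proof. by apply: sorted_part; case/andP: mu_part. Qed.

Lemma nu_le i j : (i <= j)%N -> (part nu j <= part nu i)%N.
Proof. by apply: sorted_part; case/andP: nu_part. Qed.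

Lemma addpart_sorted : sorted geq lam.
Proof.
apply/(sortedP 0%N) => i _; rewrite -/(part lam i) -/(part lam i.+1).
by rewrite !part_addpart; apply: leq_add; [apply: mu_le | apply: nu_le].
Qed.

Lemma same_parts i j : part lam i = part lam j ->
  part mu i = part mu j /\ part nu i = part nu j.
Proof.
rewrite !part_addpart; wlog le_ij : i j / (i <= j)%N => [hw|].
  by have [/hw//|/ltnW/hw h] := leqP i j => /esym/h[-> ->].
by have := mu_le le_ij; have := nu_le le_ij; lia.
Qed.

Definition start (h : nat) : nat := index (dpart mu nu h) lam.

Lemma blockP (h : 'I_(nb_parts mu nu)) (i : nat) : (i < l)%N ->
  (part lam i == dpart mu nu h) = (start h <= i < start h + mult mu nu h)%N.
Proof. exact: (@block_eq lam addpart_sorted h i (ltn_ord h)). Qed.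

Lemma next_start (h : 'I_(nb_parts mu nu)) :
  (start h + mult mu nu h = if h.+1 < nb_parts mu nu then start h.+1 else l)%N.
Proof. exact: (@next_block lam addpart_sorted h (ltn_ord h)). Qed.

Lemma start_lt (h : 'I_(nb_parts mu nu)) : (start h < l)%N.
Proof. by rewrite index_mem; apply: distinct_in. Qed.

Lemma mult_gt0 (h : 'I_(nb_parts mu nu)) : (0 < mult mu nu h)%N.
Proof. by rewrite -has_count has_pred1; apply: distinct_in. Qed.

Lemma block_end (h : 'I_(nb_parts mu nu)) : (start h + mult mu nu h <= l)%N.
Proof. exact: index_count_le. Qed.

Lemma start0 : start 0 = 0%N.
Proof.
rewrite /start /dpart; have [l0|l_gt0] := posnP l; first by rewrite (size0nil l0).
pose z := nth 0%N lam 0; have zu : z \in undup lam by rewrite mem_undup mem_nth.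
have le_z := distinct_le addpart_sorted (leq0n (index z (undup lam))).
rewrite nth_index // in le_z; set d := nth 0%N (undup lam) 0 in le_z *.
have lt0 : (0 < size (undup lam))%N by case: (undup lam) zu.
have d_in := distinct_in lt0; rewrite -/d in d_in.
have := sorted_part addpart_sorted (leq0n (index d lam)).
rewrite /part nth_index // -/z => ge_z.
have zd : nth 0%N lam 0 = d by apply/eqP; rewrite eqn_leq ge_z le_z.
by rewrite -zd /z; case: lam l_gt0 => //= a s _; rewrite eqxx.
Qed.

Lemma jval_next (h : 'I_(nb_parts mu nu)) :
  jval mu nu h.+1 = part mu (start h + mult mu nu h).
Proof.
rewrite /jval next_start; case: ifP => // _.
by rewrite /part nth_default // size_addpart leq_maxl.
Qed.

Lemma jvalE (h : 'I_(nb_parts mu nu)) : jval mu nu h = part mu (start h).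
Proof. by rewrite /jval ltn_ord. Qed.

(** The indices at which the vector needs a generator, one for each h in J: the
    last index of I_h. The conditions say that no other pair of parts (mu_j, nu_j)
    has mu_j >= mu_i and nu_j <= nu_i, the last index being preferred among
    equal pairs. *)
Definition pivots : {set 'I_l} :=
  [set i : 'I_l | (part mu i.+1 < part mu i)%N &&
    [forall j : 'I_l, (j < i)%N && (part nu j == part nu i) ==>
                      (part mu j == part mu i)]].

Lemma block_parts (h : 'I_(nb_parts mu nu)) i :
  (start h <= i < start h + mult mu nu h)%N ->
  part mu i = part mu (start h) /\ part nu i = part nu (start h).
Proof.
move=> ih; have lt_i : (i < l)%N.
  by case/andP: ih => _ lt_i; apply: leq_trans (block_end h).
apply: same_parts; move: ih; rewrite -blockP // => /eqP->.
by apply/esym/eqP; rewrite blockP ?start_lt // leqnn -addn1 leq_add2l mult_gt0.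
Qed.

Lemma prev_start (h : 'I_(nb_parts mu nu)) : (0 < h)%N ->
  (0 < start h)%N /\ part nu (start h).-1 = kval mu nu h.-1.
Proof.
move=> h_gt0; have lt_h : (h.-1 < nb_parts mu nu)%N.
  by rewrite (leq_ltn_trans (leq_pred _)).
have := next_start (Ordinal lt_h); rewrite /= prednK // ltn_ord => <-.
have := mult_gt0 (Ordinal lt_h) => /= m_gt0.
split; first by rewrite addn_gt0 m_gt0 orbT.
have [/=|_ ->//] :=
  @block_parts (Ordinal lt_h) (start h.-1 + mult mu nu h.-1).-1.
by lia.
Qed.

(** At the last index i of I_h one has mu_(i+1) = j_(h+1). As nu is constant on
    I_h and non-increasing, an index j < i with nu_j = nu_i outside I_h exists
    exactly when k_(h-1) = k_h, and then mu_j differs from mu_i since lam_j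
    differs from lam_i. So both conditions of a pivot are those defining J. *)
Lemma pivot_block (h : 'I_(nb_parts mu nu)) (i : 'I_l) :
  (start h <= i < start h + mult mu nu h)%N ->
  (i \in pivots) = (h \in Jset mu nu) && (i.+1 == start h + mult mu nu h)%N.
Proof.
move=> ih; have [mu_i nu_i] := block_parts ih; rewrite !inE jval_next jvalE.
have [last_i|not_last] := eqVneq i.+1 (start h + mult mu nu h)%N; last first.
  have /block_parts[mu_i1 _] : (start h <= i.+1 < start h + mult mu nu h)%N by lia.
  by rewrite mu_i1 mu_i ltnn andbF.
rewrite andbT last_i mu_i nu_i; congr (_ && _).
have -> : kval mu nu h = part nu (start h) by [].
have in_block (j : 'I_l) : (start h <= j)%N -> (j < i)%N ->
    part mu j == part mu (start h).
  by move=> le_j lt_j; have [|-> //] := @block_parts h j; lia.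
have [h0|h_gt0] := posnP h.
  by apply/forallP=> j; apply/implyP=> /andP[lt_j _]; rewrite in_block // h0 start0.
have [st_gt0 nu_prev] := prev_start h_gt0; rewrite -nu_prev /=.
have [nu_lt|nu_ge] := ltnP (part nu (start h)) (part nu (start h).-1).
  apply/forallP=> j; apply/implyP=> /andP[lt_j /eqP nu_j].
  apply: in_block => //; rewrite leqNgt; apply/negP => lt_js.
  by have := @nu_le j (start h).-1; lia.
apply/negP => /forallP; have lt_p : ((start h).-1 < l)%N.
  by rewrite (leq_ltn_trans (leq_pred _)) // start_lt.
move/(_ (Ordinal lt_p)); have -> : part nu (start h).-1 = part nu (start h).
  by apply/eqP; rewrite eqn_leq nu_ge nu_le // leq_pred.
rewrite eqxx andbT /=; case/andP: ih => le_i _.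
rewrite (_ : (start h).-1 < i)%N /=; last by rewrite prednK.
move=> /eqP mu_p; have := blockP h lt_p.
rewrite [(start h <= _)%N]leqNgt prednK // leqnn /=.
rewrite part_addpart mu_p => /negbT/eqP; apply.
have -> : part nu (start h).-1 = part nu (start h).
  by apply/eqP; rewrite eqn_leq nu_ge nu_le // leq_pred.
rewrite -part_addpart; apply/eqP; rewrite blockP ?start_lt //.
by rewrite leqnn -addn1 leq_add2l mult_gt0.
Qed.

Lemma GLsize_le (h : 'I_(nb_parts mu nu)) : (GLsize h <= mult mu nu h)%N.
Proof. by rewrite /GLsize; case: ifP => // _; apply: leq_pred. Qed.

Lemma pivotN_block (h : 'I_(nb_parts mu nu)) (i : 'I_l) :
  (start h <= i < start h + mult mu nu h)%N ->
  (i \notin pivots) = (i < start h + GLsize h)%N.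
Proof.
move=> ih; have := mult_gt0 h; rewrite (pivot_block ih) /GLsize.
by case: (h \in Jset mu nu) => /=; lia.
Qed.

Local Notation m := (\sum_h @GLsize mu nu h)%N.
Implicit Types a b : 'I_m.

Lemma theta_in_block a :
  (start (tagnat.sig1 a) <= start (tagnat.sig1 a) + tagnat.sig2 a <
   start (tagnat.sig1 a) + mult mu nu (tagnat.sig1 a))%N.
Proof. by rewrite leq_addr ltn_add2l (leq_trans (ltn_ord _)) ?GLsize_le. Qed.

Fact theta_lt a : (start (tagnat.sig1 a) + tagnat.sig2 a < l)%N.
Proof.
by case/andP: (theta_in_block a) => _ lt_a; apply: leq_trans lt_a (block_end _).
Qed.

(** The pivot of a block, if any, is its last index: so the first [GLsize h]
    indices of I_h, over all h, are the indices outside [pivots]. *)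
Definition theta a : 'I_l := Ordinal (theta_lt a).

Lemma theta_block a : part lam (theta a) = dpart mu nu (tagnat.sig1 a).
Proof. by apply/eqP; rewrite blockP ?theta_in_block. Qed.

Lemma theta_lam a b :
  (part mu (theta a) + part nu (theta a) == part mu (theta b) + part nu (theta b))%N
  = (tagnat.sig1 a == tagnat.sig1 b).
Proof. by rewrite -!part_addpart !theta_block /dpart distinct_eq. Qed.

Lemma theta_inj : injective theta.
Proof.
move=> a b ab; have ab1 : tagnat.sig1 a = tagnat.sig1 b.
  by apply/eqP; rewrite -theta_lam ab.
have ab2 : tagnat.sig2 a = tagnat.sig2 b :> nat.
  have := congr1 (start \o val) ab1; move/(congr1 val): ab => /=; lia.
apply: val_inj; apply/eqP; rewrite /= -[a]tagnat.sig2K -[b]tagnat.sig2K.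
by rewrite tagnat.eq_Rank; apply/andP; split; apply/eqP.
Qed.

Lemma theta_pivots a : theta a \notin pivots.
Proof. by rewrite (@pivotN_block _ (theta a) (theta_in_block a)) ltn_add2l. Qed.

Lemma theta_onto (p : 'I_l) : p \notin pivots -> exists a, theta a = p.
Proof.
move=> npiv; have pu : part lam p \in undup lam by rewrite mem_undup mem_nth.
have lt_h : (index (part lam p) (undup lam) < nb_parts mu nu)%N by rewrite index_mem.
pose h := Ordinal lt_h; have ph : (start h <= p < start h + mult mu nu h)%N.
  by rewrite -blockP // /dpart nth_index.
move: npiv; rewrite (pivotN_block ph); case/andP: ph => le_p _ lt_p.
have lt_s : (p - start h < GLsize h)%N by lia.
exists (tagnat.Rank h (Ordinal lt_s)); apply: val_inj => /=.
have := tagnat.rankK (Tagged (fun h => 'I_(GLsize h)) (Ordinal lt_s)).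
by rewrite /tagnat.sig1 /tagnat.sig2 => -> /=; rewrite subnKC.
Qed.

Lemma mu_nu_mono (p r : 'I_l) :
  (part nu r < part nu p)%N -> (part mu r <= part mu p)%N.
Proof. by have [/nu_le|/ltnW/mu_le] := leqP r p; lia. Qed.

Lemma pivot_gt0 (r : 'I_l) : r \in pivots -> (0 < part mu r)%N.
Proof. by rewrite inE => /andP[lt_r _]; apply: leq_ltn_trans lt_r. Qed.

Lemma pivot_anti (r r' : 'I_l) : r \in pivots -> r' \in pivots ->
  (part mu r <= part mu r')%N -> (part nu r' <= part nu r)%N -> r = r'.
Proof.
rewrite !inE => /andP[r_lt /forallP r_nu] /andP[r'_lt _] le_mu le_nu.
apply: val_inj; have [lt_r|lt_r|//] := ltngtP r r'.
  by have := mu_le lt_r; lia.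
have eq_nu : part nu r' = part nu r by have := nu_le (ltnW lt_r); lia.
have := r_nu r'; rewrite lt_r eq_nu eqxx /= => /eqP eq_mu.
by have := mu_le lt_r; lia.
Qed.

(** Among the indices whose parts dominate those at p, one maximising
    mu_i - nu_i, then i, is a pivot. *)
Lemma pivot_exists (p : 'I_l) : (0 < part mu p)%N ->
  exists r, [/\ r \in pivots, (part mu p <= part mu r)%N
              & (part nu r <= part nu p)%N].
Proof.
move=> mu_gt0.
pose D (i : 'I_l) := (part mu p <= part mu i)%N && (part nu i <= part nu p)%N.
(* The term part nu p makes the difference mu_i - nu_i non-negative. *)
pose key (i : 'I_l) := ((part mu i + (part nu p - part nu i)) * l.+1 + i)%N.
have key_lt (i j : 'I_l) :
    (part mu i + (part nu p - part nu i) < part mu j + (part nu p - part nu j))%N ->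
    (key i < key j)%N.
  rewrite /key => lt_ij; have lt_i := ltn_ord i.
  have : ((part mu i + (part nu p - part nu i)).+1 * l.+1 <=
          (part mu j + (part nu p - part nu j)) * l.+1)%N.
    by rewrite leq_mul2r lt_ij orbT.
  by rewrite mulSn; lia.
have Dp : D p by rewrite /D !leqnn.
have [r /andP[le_mu le_nu] max_r] := arg_maxnP key Dp.
exists r; split=> //; rewrite inE; apply/andP; split.
  rewrite ltnNge; apply/negP => le_r1.
  have lt_r1 : (r.+1 < l)%N.
    rewrite [X in (_ < X)%N]size_addpart leq_max -part_gt0 //.
    by rewrite (leq_trans _ le_r1) // (leq_trans mu_gt0).
  pose r1 := Ordinal lt_r1; have r1E : r1 = r.+1 :> nat by [].
  have := max_r r1; rewrite /D /key r1E.
  have := mu_le (leqnSn r); have := nu_le (leqnSn r) => le1 le2.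
  have eq_mu : part mu r.+1 = part mu r by lia.
  rewrite eq_mu le_mu (leq_trans le1 le_nu) => /(_ isT).
  have : ((part mu r + (part nu p - part nu r)) * l.+1 <=
          (part mu r + (part nu p - part nu r.+1)) * l.+1)%N.
    by rewrite leq_mul2r; lia.
  by lia.
apply/forallP=> j; apply/implyP=> /andP[lt_j /eqP nu_j].
have le_mu_j := mu_le (ltnW lt_j); rewrite eqn_leq le_mu_j andbT leqNgt.
apply/negP => lt_mu; have := max_r j; rewrite /D nu_j le_nu (leq_trans le_mu) //.
move=> /(_ isT) le_key; have := key_lt r j; rewrite nu_j ltn_add2r => /(_ lt_mu).
by rewrite ltnNge => /negP; apply.
Qed.

End Bipartitions.

(** * Counting *)

Lemma sum_minn (f : nat -> nat) n :
  (forall i j, (i <= j)%N -> (f j <= f i)%N) ->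
  (\sum_(i < n) \sum_(j < n) minn (f i) (f j) = \sum_(i < n) (2 * i + 1) * f i)%N.
Proof.
move=> f_le; elim: n => [|n IHn]; first by rewrite !big_ord0.
rewrite !big_ord_recr /= minnn.
have minn_n (i : 'I_n) : minn (f i) (f n) = f n.
  by apply/minn_idPr/f_le/ltnW.
rewrite (eq_bigr (fun i : 'I_n => \sum_(j < n) minn (f i) (f j) + f n)%N).
  have -> : (\sum_(j < n) minn (f n) (f j) = n * f n)%N.
    rewrite -[X in (X * _)%N]card_ord -sum_nat_const; apply: eq_bigr => j _.
    by rewrite minnC.
  rewrite big_split /= IHn sum_nat_const card_ord.
  by rewrite mulnDl mul1n mul2n -addnn mulnDl !addnA.
by move=> i _; rewrite big_ord_recr /= minn_n.
Qed.

Lemma sum_part (c : nat -> nat) s n : (size s <= n)%N ->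
  (\sum_(i < size s) c i * part s i = \sum_(i < n) c i * part s i)%N.
Proof.
move=> le_n; rewrite (big_ord_widen n (fun i => c i * part s i)%N) //.
rewrite big_mkcond; apply: eq_bigr => i _; case: ltnP => // le_i.
by rewrite /part nth_default // muln0.
Qed.

Lemma sumn_part s : sumn s = (\sum_(i < size s) part s i)%N.
Proof. by rewrite sumnE (big_nth 0%N) big_mkord. Qed.

(** The left-hand side is the dimension of the centraliser of x. *)
Lemma sum_minn_addpart mu nu : is_partition mu -> is_partition nu ->
  let lam i := (part mu i + part nu i)%N in
  (\sum_(i < size (addpart mu nu)) \sum_(j < size (addpart mu nu)) minn (lam i) (lam j)
   = bstat mu nu + \sum_(i < size (addpart mu nu)) part mu i)%N.
Proof.
move=> mu_part nu_part lam; rewrite (@sum_minn lam) => [|i j le_ij]; last first.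
  by rewrite leq_add ?mu_le ?nu_le.
have le_mu : (size mu <= size (addpart mu nu))%N by rewrite size_addpart leq_maxl.
have le_nu : (size nu <= size (addpart mu nu))%N by rewrite size_addpart leq_maxr.
have sum_nu : sumn nu = (\sum_(i < size (addpart mu nu)) 1 * part nu i)%N.
  rewrite -(@sum_part (fun=> 1%N)) // sumn_part.
  by apply: eq_bigr => i _; rewrite mul1n.
rewrite /bstat /nstat sum_nu (sum_part id le_mu) (sum_part id le_nu) !big_distrr /=.
rewrite -!big_split /=; apply: eq_bigr => i _.
by rewrite /lam mulnDr !mulnDl; lia.
Qed.

Lemma sum_sig1 n (r : 'I_n -> nat) (G : 'I_n -> nat) :
  (\sum_(a < \sum_h r h) G (tagnat.sig1 a) = \sum_h r h * G h)%N.
Proof.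
transitivity (\sum_h \sum_(j < r h) G h)%N.
  by rewrite sig_big_dep (reindex _ tagnat.sig_bij_on).
by apply: eq_bigr => h _; rewrite sum_nat_const card_ord.
Qed.

Lemma sum_same_block n (r : 'I_n -> nat) :
  (\sum_(a < \sum_h r h) \sum_(b < \sum_h r h) (tagnat.sig1 b == tagnat.sig1 a)
   = \sum_h r h ^ 2)%N.
Proof.
rewrite (eq_bigr (fun a => r (tagnat.sig1 a))) => [|a _].
  by rewrite (sum_sig1 r r); apply: eq_bigr => h _; rewrite mulnn.
rewrite (sum_sig1 r (fun h => h == tagnat.sig1 a : nat)).
rewrite (bigD1 (tagnat.sig1 a)) //= eqxx muln1 big1 ?addn0 // => h /negPf->.
by rewrite muln0.
Qed.

(** * The structure of the stabiliser *)

Section JordanBasis.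
Variables (k : closedFieldType) (V : vectType k) (x : 'End(V)).
Variables (lam : seq nat) (e : nat -> nat -> V).
Hypothesis basis_e : jordan_basis x lam e.

Lemma jordan_xpow i s : (i < size lam)%N -> (s < part lam i)%N ->
  xpow x s (e i (part lam i)) = e i (part lam i - s)%N.
Proof.
case: basis_e => _ x_e _ lt_i; elim: s => [|s IHs] lt_s.
  by rewrite xpow0 subn0.
by rewrite xpowS IHs 1?ltnW // x_e ?subnS // leq_subr ltn_subRL addn1 lt_s.
Qed.

Lemma jordan_xpow0 i : (i < size lam)%N -> (0 < part lam i)%N ->
  xpow x (part lam i) (e i (part lam i)) = 0.
Proof.
case: basis_e => _ _ x_e1 lt_i gt0; rewrite -{1}(prednK gt0) xpowS.
by rewrite jordan_xpow ?prednK // -subn1 subKn // x_e1.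
Qed.

Lemma jordan_generates (Y : {vspace V}) :
  (forall i s, (i < size lam)%N -> xpow x s (e i (part lam i)) \in Y) -> Y = fullv.
Proof.
case: basis_e => bas _ _ genY; apply/eqP; rewrite eqEsubv subvf.
rewrite -(span_basis bas); apply/span_subvP => w.
case/allpairsPdep=> i [j []]; rewrite !mem_iota add0n add1n ltnS /=.
move=> lt_i /andP[j_gt0 le_j] ->; have := genY i (part lam i - j)%N lt_i.
by rewrite jordan_xpow ?subKn //; lia.
Qed.

End JordanBasis.

Theorem theorem2p10 (k : closedFieldType) (V : vectType k) (n : nat)
    (dimV : \dim {:V} = n) (mu nu : seq nat) (mu_nu : bipartition n mu nu)
    (v : V) (x : 'End(V)) (vx : enhanced_orbit mu nu v x) :
  let H := @GLprod k (nb_parts mu nu) (@GLsize mu nu) in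
  exists (W : vectType k) (U : 'End(W) -> Prop)
         (alpha : 'M[k]_(\sum_h @GLsize mu nu h) -> 'End(W) -> 'End(W))
         (d : nat),
    [/\ closed_subgroup U /\ unipotent U,
        alg_action H U alpha,
        alg_group_iso (stabiliser v x) (fun g h => (g \o h)%VF)
                      (prod_variety U H) (sdprod_mul alpha),
        d%:Z = (bstat mu nu)%:Z
               - \sum_(h | h \notin Jset mu nu) (mult mu nu h)%:Z ^+ 2
               - \sum_(h | h \in Jset mu nu) ((mult mu nu h)%:Z - 1) ^+ 2
      & variety_iso U (@affine_space k d)].
Proof.
move=> H; case: mu_nu => mu_part nu_part size_n; case: vx => _ [e [jb vE]].
pose l := size (addpart mu nu).
pose mu' (i : 'I_l) := part mu i; pose nu' (i : 'I_l) := part nu i.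
pose lam' i := (mu' i + nu' i)%N.
have lamE (i : 'I_l) : part (addpart mu nu) i = lam' i by apply: part_addpart.
have lam_gt0 i : (0 < lam' i)%N by apply: addpart_gt0.
pose R := pivots mu nu.
pose rho p := odflt p
  [pick r in R | (mu' p <= mu' r)%N && (nu' r <= nu' p)%N].
have rhoP p : (0 < mu' p)%N ->
    [/\ rho p \in R, (mu' p <= mu' (rho p))%N & (nu' (rho p) <= nu' p)%N].
  move=> /(pivot_exists mu_part nu_part)[r [Rr le_mu le_nu]].
  rewrite /rho; case: pickP => [r' /andP[Rr' /andP[]] //|/(_ r)].
  by rewrite /= Rr le_mu le_nu.
pose u (i : 'I_l) := e i (lam' i).
have u0 i : xpow x (lam' i) (u i) = 0.
  by rewrite /u -lamE (jordan_xpow0 jb) // lamE.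
have vu : v = normal_vector x nu' (absorb x mu' nu' R rho u) R.
  rewrite -(absorb_normal_vector rhoP u0) vE big_mkcond.
  apply: eq_bigr => i _; case: posnP => [mu0|mu_gt0].
    by have := u0 i; rewrite /lam' /mu' mu0.
  rewrite /u -lamE (jordan_xpow jb) //; rewrite lamE /lam' /mu' /nu'.
    by rewrite addnK.
  by rewrite -{1}[part nu i]add0n ltn_add2r.
have [||F gens] := @jordan_generators_exist _ _ x _ lam' _ (absorb_killed rhoP u0).
- rewrite dimV -size_n sumn_part; apply: eq_bigr => i _.
  by rewrite -lamE.
- move=> Y /absorb_generates genY; apply: (jordan_generates jb) => i s lt_i.
  by have := genY (Ordinal lt_i) s; rewrite /u -lamE.
have anti := @pivot_anti _ _ mu_part nu_part.
have gt0 := @pivot_gt0 mu nu.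
have th_inj := theta_inj mu_part nu_part.
have th_piv := theta_pivots mu_part nu_part.
have th_onto := theta_onto mu_part nu_part.
have th_lam := theta_lam mu_part nu_part.
have mono := @mu_nu_mono _ _ mu_part nu_part.
have [A [inA dimA]] :=
  dim_kernel gens lam_gt0 mono gt0 rhoP th_inj th_piv.
rewrite vu; exists V, (fun g => g - \1%VF \in A),
  (levi_conj x mu' nu' (absorb x mu' nu' R rho u) F R (@theta mu nu)),
  (\dim A).
split.
- split; last exact: (U_unipotent gens lam_gt0 gt0 anti th_onto inA).
  exact: (U_closed_subgroup gens lam_gt0 gt0 anti th_inj th_piv th_onto inA).
- exact: (levi_conj_action gens lam_gt0 gt0 anti th_inj th_piv th_onto th_lam inA).
- exact: (levi_decomposition gens lam_gt0 gt0 anti th_inj th_piv th_onto th_lam inA).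
- have : (bstat mu nu = \dim A + \sum_(h : 'I_(nb_parts mu nu)) GLsize h ^ 2)%N.
    have := sum_minn_addpart mu_part nu_part; rewrite /= -/l => minE.
    move: dimA; rewrite minE => /addIn ->; congr (_ + _)%N.
    rewrite -sum_same_block; apply: eq_bigr => a _; apply: eq_bigr => b _.
    by rewrite th_lam.
  move=> ->; rewrite PoszD (big_morph Posz PoszD (erefl _)).
  rewrite (bigID (mem (Jset mu nu))) /= addrA.
  have -> : \sum_(h in Jset mu nu) (GLsize h ^ 2)%:Z =
            \sum_(h in Jset mu nu) ((mult mu nu h)%:Z - 1) ^+ 2.
    apply: eq_bigr => h Jh; rewrite /GLsize Jh -mulnn PoszM -subn1 -subzn //.
    exact: mult_gt0.
  have -> : \sum_(h | h \notin Jset mu nu) (GLsize h ^ 2)%:Z =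
            \sum_(h | h \notin Jset mu nu) (mult mu nu h)%:Z ^+ 2.
    by apply: eq_bigr => h /negPf nJh; rewrite /GLsize nJh -mulnn PoszM.
  by rewrite addrK addrK.
- exact: variety_iso_affine.
Qed.
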